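(* Let $b,c>0$ be constants and let $V\in L^1_{\mathrm{loc}}(\mathbb{R})$ be real valued and satisfy $$\lim_{|x|\to\infty}\int_x^{x+1}|V(s)|\,ds=0.$$ Let $H_V$ be the maximal operator associated with $-c^2\frac{d^2}{dx^2}+b^2+V(x)$ in $L^2(\mathbb{R})$, and let $\kappa_-(H_V)\ge 1$ be the number of negative eigenvalues of $H_V$. Consider the spectral problem $$-c^2y''+b^2y+V(x)y=-\mathrm{i}\,z\,y',\qquad x\in\mathbb{R}. \qquad (\ast)$$ Then: (i) If $\ker(H_V)=\{0\}$, then $(\ast)$ is spectrally unstable. (ii) If $\ker(H_V)=\mathrm{span}\{\psi_0\}\neq\{0\}$ and $\mathbf{D}_V\neq 0$, then $(\ast)$ is spectrally stable if and only if $\kappa_-(H_V)=1$ and $\mathbf{D}_V<0$. (iii) If $\ker(H_V)=\mathrm{span}\{\psi_0\}\neq\{0\}$ and either $\kappa_-(H_V)$ is odd and $\mathbf{D}_V>0$, or $\kappa_-(H_V)$ is even and $\mathbf{D}_V<0$, then $(\ast)$ has at least one purely imaginary eigenvalue $z\in\mathrm{i}\mathbb{R}_{>0}$.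
   Context: The maximal operator $H_V$ acts as $H_Vu=-c^2u''+b^2u+Vu$ on $\mathrm{dom}(H_V)=\{u\in L^2(\mathbb{R}): u,u'\in AC_{\mathrm{loc}}(\mathbb{R}),\ -c^2u''+b^2u+Vu\in L^2(\mathbb{R})\}$. Under the assumptions on $V$ it is self-adjoint, bounded from below, its essential spectrum is $[b^2,\infty)$, $\mathrm{dom}(H_V)\subset H^1(\mathbb{R})$, and $\ker(H_V)$ is at most one-dimensional. The number $\kappa_-(H_V)$ is the total multiplicity of the negative spectrum of $H_V$. Spectral (in)stability: a number $z\in\mathbb{C}$ is an eigenvalue of $(\ast)$ if there is $\psi_z\in\mathrm{dom}(H_V)$, $\psi_z\ne0$ (called an eigenfunction), such that $H_V\psi_z=-\mathrm{i}z\psi_z'$. An eigenvalue $z\neq0$ is called unstable if either $z\notin\mathbb{R}$, or $z\in\mathbb{R}\setminus\{0\}$ and $(H_V\psi_z,\psi_z)_{L^2}\le0$ for some eigenfunction $\psi_z\neq0$. The problem $(\ast)$ is called spectrally stable if it has no unstable eigenvalues, and spectrally unstable otherwise. The quantity $\mathbf{D}_V$ is defined when $\ker(H_V)=\mathrm{span}\{\psi_0\}$ with $\psi_0\ne0$ by $$\mathbf{D}_V:=(H_V^{-1}\psi_0',\psi_0')_{L^2},$$ i.e. $\mathbf{D}_V=(\varphi,\psi_0')_{L^2}$ for any $\varphi\in\mathrm{dom}(H_V)$ with $H_V\varphi=\psi_0'$. Such $\varphi$ exists, and the value does not depend on its choice since $\psi_0'\perp\ker(H_V)$; the sign of $\mathbf{D}_V$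 does not depend on the choice of $\psi_0$. *)

(* Defs.v *)
From HB Require Import structures.
From mathcomp Require Import all_boot all_order all_algebra.
From mathcomp Require Import all_classical all_reals all_analysis.
From mathcomp Require Export complex.

Set Implicit Arguments.
Unset Strict Implicit.
Unset Printing Implicit Defensive.
Import Order.TTheory GRing.Theory Num.Theory.
Import numFieldNormedType.Exports.
Local Open Scope classical_set_scope.
Local Open Scope complex_scope.
Local Open Scope ring_scope.

Section Definitions.
Context {R : realType}.
Local Notation mu := (@lebesgue_measure R).
Local Notation C := R[i].
Local Notation Re := (@complex.Re R).
Local Notation Im := (@complex.Im R).

Definition abs_continuous_on (a b : R) (f : R -> R) : Prop :=
  forall e : R, 0 < e -> exists2 d : R, 0 < d &
    forall (n : nat) (l r : 'I_n -> R),
      (forall i, [/\ a <= l i, l i <= r i & r i <= b]) ->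
      trivIset [set: 'I_n] (fun i => [set` `]l i, r i[]) ->
      \sum_i (r i - l i) < d ->
      \sum_i `|f (r i) - f (l i)| < e.

Definition AC_loc (f : R -> R) : Prop := forall a b, abs_continuous_on a b f.

Definition AC_locC (u : R -> C) : Prop := AC_loc (Re \o u) /\ AC_loc (Im \o u).

Definition derivableC (u : R -> C) (x : R) : Prop :=
  derivable (Re \o u) x 1 /\ derivable (Im \o u) x 1.

Definition derivC (u : R -> C) (x : R) : C :=
  derive1 (Re \o u) x +i* derive1 (Im \o u) x.

Definition L2 (u : R -> C) : Prop :=
  (Re \o u) \in Lfun mu 2%:E /\ (Im \o u) \in Lfun mu 2%:E.

Definition integralC (f : R -> C) : C :=
  (\int[mu]_x Re (f x)) +i* (\int[mu]_x Im (f x)).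

Definition innerL2 (f g : R -> C) : C := integralC (fun x => f x * conjc (g x)).

Section Schroedinger.
Variables (b c : R) (V : R -> R).

(* The differential expression - c^2 u'' + b^2 u + V u.  When u' is locally
   absolutely continuous, [derivC (derivC u) x] is the second derivative for
   almost every x and a default value for the other x; accordingly the
   expression is only ever compared with other functions almost everywhere. *)
Definition tau (u : R -> C) (x : R) : C :=
  - (c ^+ 2)%:C * derivC (derivC u) x + (b ^+ 2)%:C * u x + (V x)%:C * u x.

(* Each L^2 class in the domain is represented by its continuous element, so
   that u = 0 in L^2 means that u vanishes identically.  Since u' has to be
   (a.e. equal to) a locally absolutely continuous function, u is the primitive
   of a continuous function, hence differentiable everywhere. *)
Definition domH (u : R -> C) : Prop :=
  [/\ L2 u, AC_locC u, (forall x, derivableC u x), AC_locC (derivC u) &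
      exists2 f, L2 f & {ae mu, forall x, tau u x = f x}].

(* The graph of H_V: u is in the domain and H_V u = f in L^2. *)
Definition graphH (u f : R -> C) : Prop :=
  [/\ domH u, L2 f & {ae mu, forall x, tau u x = f x}].

Definition kerH : set (R -> C) := [set u | graphH u (fun=> 0)].

Definition ker_trivial : Prop := kerH = [set (fun=> 0)].

Definition ker_spanned_by (psi0 : R -> C) : Prop :=
  psi0 <> (fun=> 0) /\ kerH = [set (fun x => a * psi0 x) | a in [set: C]].

Definition lin_indep n (psi : 'I_n -> R -> C) : Prop :=
  forall a : 'I_n -> C,
    (forall x, \sum_i a i * psi i x = 0) -> forall i, a i = 0.

(* dim ker (H_V - lambda), possibly +oo *)
Definition multiplicity (lambda : R) : \bar R :=
  ereal_sup [set n%:R%:E | n in [set n : nat |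
    exists psi : 'I_n -> R -> C, lin_indep psi /\
      forall i, graphH (psi i) (fun x => lambda%:C * psi i x)]].

(* The number of negative eigenvalues, counted with multiplicity.  As H_V is
   self-adjoint with essential spectrum [b^2, +oo[, its eigenvalues are real
   and this is the total multiplicity of the negative spectrum. *)
Definition kappa_minus : \bar R :=
  \esum_(lambda in [set lambda : R | lambda < 0]) multiplicity lambda.

(* psi <> 0 is an eigenfunction at z of - c^2 y'' + b^2 y + V y = - i z y' *)
Definition pencil_eigenfunction (z : C) (psi : R -> C) : Prop :=
  psi <> (fun=> 0) /\ graphH psi (fun x => - 'i%C * z * derivC psi x).

Definition pencil_eigenvalue (z : C) : Prop :=
  exists psi, pencil_eigenfunction z psi.

(* In the order of R[i], w <= 0 says that w is real and nonpositive, and w < 0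
   that it is real and negative. *)
Definition unstable_eigenvalue (z : C) : Prop :=
  [/\ pencil_eigenvalue z, z != 0 &
      (z \isn't Num.real) \/
      (z \is Num.real /\
       exists psi f, [/\ pencil_eigenfunction z psi, graphH psi f &
                         innerL2 f psi <= 0])].

Definition spectrally_stable : Prop := forall z, ~ unstable_eigenvalue z.

Definition spectrally_unstable : Prop := ~ spectrally_stable.

(* (H_V^{-1} psi0', psi0'), computed with any solution phi of H_V phi = psi0' *)
Definition D_V (psi0 : R -> C) : C :=
  innerL2 (xget (fun=> 0) [set phi | graphH phi (derivC psi0)]) (derivC psi0).

End Schroedinger.

Definition even_number (k : \bar R) : Prop :=
  exists2 n : nat, ~~ odd n & k = n%:R%:E.

Definition odd_number (k : \bar R) : Prop :=
  exists2 n : nat, odd n & k = n%:R%:E.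

End Definitions.

(* Main.v *)
Require Import Defs.
From HB Require Import structures.
From mathcomp Require Import all_boot all_order all_algebra.
From mathcomp Require Import finmap.
From mathcomp Require Import all_classical all_reals all_analysis.
From mathcomp Require Import complex.
From mathcomp Require Import measurable_realfun.
From mathcomp Require Import ring lra.

(** Write [H] for the operator and [psi0'] for the derivative of [psi0]. The gauge
    transformation [y = exp (i z x / (2 c^2)) w] turns the pencil equation at [z]
    into the eigenvalue equation [H w = z^2 / (4 c^2) w]. A negative eigenvalue
    [- (c m)^2] of [H] with eigenfunction [w] therefore gives the solution
    [y = exp (- m x) w] of the pencil equation at [z = 2 i c^2 m]. It is square
    integrable because [w] and its derivative decay at every rate smaller than
    [sqrt (b^2 + (c m)^2) / c], which exceeds [m] ([eigenfunction_decay],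
    [real_graph_gauge]). As [H] has a negative eigenvalue, the pencil always has an
    eigenvalue on the positive imaginary axis; this gives (i) and (iii), and shows
    that stability fails in (ii).

    On the other hand [D_V] is never negative. Indeed [H (x psi0) = - 2 c^2 psi0'], so
    that the solutions of [H phi = psi0'] are [phi = a psi0 - x psi0 / (2 c^2)]. As
    the Wronskian of [Re psi0] and [Im psi0] vanishes, the real part of
    [phi * conj psi0'] is the sum of [|psi0|^2 / (4 c^2)] and of the derivative of a
    function that vanishes at infinity ([kernel_wronskian], [kernel_form_ge0]). Thus
    both sides of the equivalence in (ii) are false.

    The decay estimate must cope with a potential that is merely locally integrable
    and small in the mean. Let [I] be a primitive of [V / c^2]. The quasi-derivative
    [U = w' - I w] satisfies [U' = k^2 w - I w'] almost everywhere, where the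
    right-hand side is continuous, so [U] is continuously differentiable. Subtracting
    from [I] its means over unit intervals leaves a planar system whose coefficients
    are vanishing perturbations of those of [w'' = k^2 w]
    ([quasi_derivative_decay_pinfty]), and a monotonicity argument for the product of [w]
    with its quasi-derivative rules out growing solutions ([hyperbolic_decay]).

    All this rests on the differentiation theory of absolutely continuous functions:
    such a function is almost everywhere differentiable and is the integral of its
    derivative ([ac_ae_derive], [AC_loc_is_derive]). It is the difference of two
    monotone absolutely continuous functions, whose Stieltjes measures have densities
    by the Radon-Nikodym theorem, and the differentiation theorem of Lebesgue applies
    to these densities. *)

Set Implicit Arguments.
Unset Strict Implicit.
Unset Printing Implicit Defensive.
Import Order.TTheory GRing.Theory Num.Theory.
Import numFieldNormedType.Exports.
Local Open Scope classical_set_scope.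
Local Open Scope ring_scope.

(** * Variation of absolutely continuous functions *)

Section IntervalFamilies.
Context {R : realType}.
Implicit Types (a b x y : R) (f F : R -> R) (s t : seq (R * R)).

(** Families of intervals are lists of pairs of endpoints, so that an interval can be
    replaced by a list of subintervals. *)
Definition nonoverlapping : rel (R * R) :=
  fun p q => (p.2 <= q.1) || (q.2 <= p.1).

Definition itv_family a b s :=
  all (fun p => [&& a <= p.1, p.1 <= p.2 & p.2 <= b]) s &&
  pairwise nonoverlapping s.

Definition total_length s := \sum_(p <- s) (p.2 - p.1).

Definition oscillation f s := \sum_(p <- s) `|f p.2 - f p.1|.

Lemma abs_continuous_on_seq a b f : abs_continuous_on a b f ->
  forall e, 0 < e -> exists2 d, 0 < d &
    forall s, itv_family a b s -> total_length s < d -> oscillation f s < e.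
Proof.
move=> acf e e0; have [d d0 dP] := acf e e0; exists d => // s /andP[/allP sab sno].
pose p0 : R * R := (0, 0).
rewrite /total_length /oscillation !(big_nth p0) !big_mkord => sd.
apply: dP => //.
- by move=> i; have /and3P[] := sab _ (mem_nth p0 (ltn_ord i)).
- apply/trivIsetP => /= i j _ _ ij; rewrite -subset0 => x [] /=.
  rewrite !in_itv/= => /andP[l1 r1] /andP[l2 r2].
  wlog ltij : i j ij l1 r1 l2 r2 / (i < j)%N => [wl|].
    move: (ij); rewrite -val_eqE neq_ltn => /orP[?|?]; first exact: (wl i j).
    by apply: (wl j i) => //; rewrite eq_sym.
  have /(pairwiseP p0)/(_ i j (ltn_ord _) (ltn_ord _) ltij)/orP[h|h] := sno.
    by move: (lt_trans (lt_le_trans r1 h) l2); rewrite ltxx.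
  by move: (lt_trans (lt_le_trans r2 h) l1); rewrite ltxx.
Qed.

Lemma itv_family_cons a b p s : itv_family a b (p :: s) =
  [&& (a <= p.1), (p.1 <= p.2), (p.2 <= b), all (nonoverlapping p) s
    & itv_family a b s].
Proof.
rewrite /itv_family /= -!andbA; do 3![congr (_ && _)].
by rewrite andbCA.
Qed.

Lemma nonoverlapping_sym p q : nonoverlapping p q = nonoverlapping q p.
Proof. by rewrite /nonoverlapping orbC. Qed.

Lemma itv_family_cat a b s t : itv_family a b (s ++ t) =
  [&& itv_family a b s, itv_family a b t & allrel nonoverlapping s t].
Proof.
rewrite /itv_family all_cat pairwise_cat.
by case: all => //=; case: all; case: pairwise; case: pairwise => //=;
  rewrite ?andbT ?andbF.
Qed.

Definition consecutive_pairs a (s : seq R) := zip (a :: s) s.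

Lemma consecutive_pairs_cons a x (s : seq R) :
  consecutive_pairs a (x :: s) = (a, x) :: consecutive_pairs x s.
Proof. by []. Qed.

Lemma consecutive_pairs_family a b (s : seq R) : itv_partition a b s ->
  itv_family a b (consecutive_pairs a s).
Proof.
elim: s a => [a [] //|x s ih a xsab].
have /ih := itv_partition_cons xsab.
have xb := itv_partition_le (itv_partition_cons xsab).
have ax : a <= x by case: xsab => /= /andP[/ltW].
rewrite consecutive_pairs_cons itv_family_cons lexx ax xb /=.
move=> /andP[sx sp]; rewrite /itv_family sp andbT; apply/andP; split.
  apply/allP => p /(allP sx) /and3P[h _ _].
  by rewrite /nonoverlapping h.
by apply/allP => p /(allP sx) /and3P[h -> ->]; rewrite (le_trans ax h).
Qed.

Lemma consecutive_pairs_length a b (s : seq R) : itv_partition a b s ->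
  total_length (consecutive_pairs a s) = b - a.
Proof.
rewrite /total_length; elim: s a => [a|x s ih a xsab].
  by move/itv_partition_nil => ->; rewrite big_nil subrr.
rewrite consecutive_pairs_cons big_cons (ih _ (itv_partition_cons xsab)) /=; ring.
Qed.

Lemma consecutive_pairs_variation a b f (s : seq R) : itv_partition a b s ->
  variation a b f s = oscillation f (consecutive_pairs a s).
Proof.
move=> sab; rewrite variation_zip// /oscillation /consecutive_pairs; move: sab => _.
elim: s a => [a|x s ih a]; first by rewrite !big_nil.
by rewrite /= !big_cons ih.
Qed.

(** Replacing each interval of a family by an arbitrary partition of it gives a
    family of the same total length, so the bound on oscillations is inherited by
    variations; one interval is subdivided at a time. *)
Lemma total_variation_family a b f (d e : R) :
  (forall s, itv_family a b s -> total_length s < d -> oscillation f s < e) ->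
  forall s, itv_family a b s -> total_length s < d ->
  (\sum_(p <- s) total_variation p.1 p.2 f <= e%:E)%E.
Proof.
move=> fde s sab sd.
(* The intervals in [t] are those that have already been subdivided. *)
suff H t : itv_family a b (s ++ t) -> total_length (s ++ t) < d ->
    (\sum_(p <- s) total_variation p.1 p.2 f + (oscillation f t)%:E <= e%:E)%E.
  have := H [::]; rewrite cats0 /oscillation big_nil adde0; exact.
elim: s t {sab sd} => [t tab td|[l r] s ih t].
  by rewrite big_nil add0e lee_fin ltW// fde.
rewrite cat_cons => stab std; rewrite big_cons /=.
have /and5P[al lr rb /= nlr stab'] : [&& a <= l, l <= r, r <= b,
    all (nonoverlapping (l, r)) (s ++ t) & itv_family a b (s ++ t)].
  by rewrite -(itv_family_cons a b (l, r)).
rewrite -addeA.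
have tvs0 : (0 <= \sum_(p <- s) total_variation p.1 p.2 f)%E.
  rewrite big_seq; apply: sume_ge0 => p ps; apply: total_variation_ge0.
  move: stab' => /andP[/allP/(_ p)]; rewrite mem_cat ps => /(_ isT).
  by case/and3P.
have key : forall z, variations l r f z ->
    (z%:E + (\sum_(p <- s) total_variation p.1 p.2 f + (oscillation f t)%:E) <= e%:E)%E.
  move=> z [u lru <-].
  rewrite (consecutive_pairs_variation _ lru) addeCA -EFinD.
  rewrite -[X in X%:E](_ : oscillation f (consecutive_pairs l u ++ t) = _); last first.
    by rewrite /oscillation big_cat.
  have /andP[ux up] := consecutive_pairs_family lru.
  have unl : allrel nonoverlapping (consecutive_pairs l u) (s ++ t).
    apply/allrelP => p q /(allP ux)/and3P[h1 h3 h2] /(allP nlr)/orP[/=|/=] h.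
      by rewrite /nonoverlapping (le_trans h2 h).
    by rewrite /nonoverlapping (le_trans h h1) orbT.
  have uab : itv_family a b (consecutive_pairs l u).
    rewrite /itv_family up andbT; apply/allP => p /(allP ux)/and3P[h1 -> h2].
    by rewrite (le_trans al h1) (le_trans h2 rb).
  apply: ih.
    move: stab'; rewrite !itv_family_cat uab => /and3P[-> -> st] /=.
    move: unl; rewrite allrel_catr => /andP[us ->] /=.
    rewrite allrel_catr st andbT allrelC; apply: sub_allrel us => p q.
    by rewrite nonoverlapping_sym.
  move: std; rewrite /total_length !(big_cat, big_cons) /=.
  rewrite -!/(total_length _) (consecutive_pairs_length lru); lra.
have [t_fin|] := boolP
  (\sum_(p <- s) total_variation p.1 p.2 f + (oscillation f t)%:E \is a fin_num)%E.
  rewrite -leeBrDr//; apply: ge_ereal_sup => _ [z zv <-].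
  by rewrite leeBrDr//; exact: key.
rewrite ge0_fin_numE; last by rewrite adde_ge0// lee_fin sumr_ge0.
rewrite -leNgt leye_eq => /eqP inf.
have [z zv] : variations l r f !=set0.
  move: lr; rewrite le_eqVlt => /predU1P[->|/(variations_neq0 f)//].
  by rewrite variationsxx; exists 0.
by have := key _ zv; rewrite inf addey.
Qed.

End IntervalFamilies.

(** * Stieltjes measures of absolutely continuous functions *)

Section StieltjesMeasure.
Context {R : realType}.
Implicit Types (a b x y : R) (f F : R -> R) (s t : seq (R * R)).

Definition interval_family s :=
  all (fun p => p.1 <= p.2) s && pairwise nonoverlapping s.

(** The global form of absolute continuity, suited to Stieltjes measures on the whole
    line. *)
Definition uniformly_ac F := forall e, 0 < e -> exists2 d, 0 < d &
  forall s, interval_family s -> total_length s < d -> oscillation F s <= e.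

Lemma uniformly_ac_continuous F : uniformly_ac F -> continuous F.
Proof.
move=> acF x; apply/cvgrPdist_le => e e0.
have [d d0 dP] := acF e e0.
near=> y.
have yd : `|x - y| < d by near: y; apply: (@cvgr_dist_lt _ R^o) => //; exact: cvg_id.
have fam p q : p <= q -> q - p < d -> `|F q - F p| <= e.
  move=> pq pqd; have := dP [:: (p, q)].
  rewrite /interval_family /total_length /oscillation !big_seq1/= pq; exact.
have [xy|/ltW yx] := leP x y.
  by rewrite distrC; apply: fam => //; rewrite (le_lt_trans (ler_norm _))// distrC.
by apply: fam => //; rewrite (le_lt_trans (ler_norm _)).
Unshelve. all: by end_near. Qed.

Lemma lebesgue_stieltjes_itv (F : cumulative R R) a b : a <= b ->
  lebesgue_stieltjes_measure F `]a, b] = (F b - F a)%:E.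
Proof.
move=> ab; rewrite /lebesgue_stieltjes_measure /measure_extension.
by rewrite measurable_mu_extE/=; [rewrite wlength_itv_bnd|exact: is_ocitv].
Qed.

(** A finite union of half-open intervals is a disjoint one, and the endpoints of its
    components compute all Stieltjes measures at once. *)
Lemma ring_interval_family (B : set R) :
  (measurable (B : set (SetRing.type (ocitv_type R)))) ->
  exists2 s, interval_family s &
    forall F : cumulative R R,
      lebesgue_stieltjes_measure F B = (\sum_(p <- s) (F p.2 - F p.1))%:E.
Proof.
move=> /SetRing.ring_finite_set[D [Dfin Dne Dtriv Dm ->]].
have /choice[g gP] : forall X : set R, exists p : R * R,
    X \in D -> p.1 < p.2 /\ X = `]p.1, p.2]%classic.
  move=> X; have [XD|] := pselect (X \in D); last by exists (0, 0).
  have /ocitvP[X0|[p p12 XE]] := Dm _ XD; last by exists p.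
  by have /set0P := Dne _ (set_mem XD); rewrite X0 eqxx.
have inD X : (X \in fset_set D) = (X \in D) by rewrite in_fset_set.
exists (map g (fset_set D)).
  apply/andP; split.
    by apply/allP => _ /mapP[X + ->]; rewrite inD => /gP[/ltW].
  rewrite pairwise_map; apply/(pairwiseP set0) => i j iD jD ij.
  have XD := mem_nth set0 iD; have YD := mem_nth set0 jD.
  have := nth_uniq set0 iD jD (fset_uniq _); rewrite (ltn_eqF ij).
  move: (nth _ _ i) (nth _ _ j) XD YD => X Y; rewrite !inD => XD YD XY.
  have [X12 XE] := gP _ XD; have [Y12 YE] := gP _ YD.
  rewrite /= /nonoverlapping; apply: contraFT XY.
  rewrite negb_or -!ltNge => /andP[h1 h2]; apply/eqP.
  apply: (Dtriv X Y (set_mem XD) (set_mem YD)).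
  move: (g X) (g Y) XE YE X12 Y12 h1 h2 => p q -> -> X12 Y12 h1 h2.
  exists (Num.min p.2 q.2); split => /=; rewrite in_itv/= lt_min ge_min lexx.
    by rewrite X12 h2.
  by rewrite h1 Y12 orbT.
move=> F; rewrite big_map -sumEFin.
have mD (X : set R) : X \in D -> measurable X.
  by move/gP => [_ ->]; exact: measurable_itv.
rewrite measure_fin_bigcup//; last by move=> X /mem_set/mD.
rewrite fsbig_finite//= big_seq [RHS]big_seq; apply: eq_bigr => X.
rewrite inD => /gP[/ltW X12 {1}->]; exact: lebesgue_stieltjes_itv.
Qed.

(** A null set is covered by countably many half-open intervals of small total length;
    each finite union of them is a disjoint union of intervals of small total length,
    on which absolute continuity bounds the increments of [F]. *)
Lemma uniformly_ac_dominated (F : cumulative R R) : uniformly_ac F ->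
  lebesgue_stieltjes_measure F `<< @lebesgue_measure R.
Proof.
move=> acF; apply/null_content_dominatesP => A mA A0.
apply/eqP; rewrite eq_le measure_ge0 andbT; apply/lee_addgt0Pr => e e0.
rewrite add0e; have [d d0 dP] := acF e e0.
have A_fin : (@lebesgue_measure R A \is a fin_num) by rewrite A0.
have [_ [I [mI AI] <-]] := lb_ereal_inf_adherent d0 A_fin.
rewrite -/(measure_extension _ _) [X in (_ < X + _)%E -> _]A0 add0e => Id.
pose B n := \big[setU/set0]_(k < n) I k.
have mB n : measurable (B n : set (SetRing.type (ocitv_type R))).
  by apply: bigsetU_measurable => k _; exact: sub_gen_smallest.
have mIR k : measurable (I k : set (measurableTypeR R)) by exact: sub_sigma_algebra.
have mBR n : measurable (B n : set (measurableTypeR R)).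
  by apply: bigsetU_measurable => k _.
have Bd n : (lebesgue_measure (B n) < d%:E)%E.
  apply: le_lt_trans Id.
  apply: (@le_trans _ _ (\sum_(k < n) lebesgue_measure (I k))%E).
    exact: content_subadditive.
  rewrite (eq_bigr (fun k : 'I_n => wlength idfun (I k))) => [|k _].
    rewrite -(big_mkord xpredT (fun k => wlength idfun (I k))).
    exact: nneseries_lim_ge.
  exact: measurable_mu_extE.
have Be n : (lebesgue_stieltjes_measure F (B n) <= e%:E)%E.
  have [s sfam sE] := ring_interval_family (mB n).
  rewrite sE lee_fin; apply: le_trans (dP _ sfam _).
    by apply: ler_sum => p _; exact: ler_norm.
  by rewrite -lte_fin; have := Bd n; rewrite /lebesgue_measure sE.
have cB : lebesgue_stieltjes_measure F \o B @ \oo -->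
    lebesgue_stieltjes_measure F (\bigcup_n B n).
  apply: nondecreasing_cvg_mu => //; first exact: bigcupT_measurable.
  by move=> m n mn; apply/subsetPset; exact: subset_bigsetU.
apply: (@le_trans _ _ (lebesgue_stieltjes_measure F (\bigcup_n B n))).
  apply: le_measure; rewrite ?inE//; first exact: bigcupT_measurable.
  by move=> x /AI[k _ Ikx]; exists k.+1 => //; rewrite /B big_ord_recr; right.
rewrite -(cvg_lim _ cB)//; apply: lime_le; first by apply/cvg_ex; eexists; exact: cB.
exact: nearW.
Qed.

End StieltjesMeasure.

(** * Densities of monotone absolutely continuous functions *)

Section Densities.
Context {R : realType}.
Implicit Types (a b x y : R) (f F : R -> R) (s t : seq (R * R)).

(** The Radon-Nikodym theorem, applied to the Stieltjes measure of [F]. *)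
Lemma uniformly_ac_density F M : {homo F : x y / x <= y} -> uniformly_ac F ->
  (forall x, `|F x| <= M) ->
  exists2 g : R -> R, lebesgue_measure.-integrable setT (EFin \o g) &
    forall x y, x <= y ->
      F y - F x = \int[lebesgue_measure]_(t in `]x, y]) g t.
Proof.
move=> ndF acF FM.
have rcF : right_continuous F by apply: right_continuousW; exact: uniformly_ac_continuous.
pose cF : cumulative R R := HB.pack F (isCumulative.Build R _ R F ndF rcF).
have fin : fin_num_fun (lebesgue_stieltjes_measure cF).
  apply: lty_fin_num_fun.
  pose I (n : nat) : set R := `](- n%:R), n%:R]%classic.
  have cT : lebesgue_stieltjes_measure cF \o I @ \oo -->
      lebesgue_stieltjes_measure cF setT.
    have -> : [set: measurableTypeR R] = \bigcup_n I n by rewrite (bigcup_itvT false false).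
    apply: nondecreasing_cvg_mu => //.
    - by move=> k; exact: measurable_itv.
    - by apply: bigcupT_measurable => k; exact: measurable_itv.
    move=> m n mn; apply/subsetPset; apply: subset_itv; rewrite bnd_simp.
      by rewrite lerN2 ler_nat.
    by rewrite ler_nat.
  apply: (@le_lt_trans _ _ (M + M)%:E); last exact: ltry.
  suff : (limn (lebesgue_stieltjes_measure cF \o I) <= (M + M)%:E)%E.
    by rewrite (cvg_lim _ cT).
  apply: lime_le; first by apply/cvg_ex; eexists; exact: cT.
  apply: nearW => n; rewrite /= lebesgue_stieltjes_itv ?ge0_cp// lee_fin.
  rewrite (le_trans (ler_norm _))// (le_trans (ler_normB _ _))// lerD//; exact: FM.
pose nu : {finite_measure set (measurableTypeR R) -> \bar R} :=
  HB.pack (lebesgue_stieltjes_measure cF)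
    (@Measure_isFinite.Build _ _ _ (lebesgue_stieltjes_measure cF) fin).
have /radon_nikodym_sigma_finite[g [g0 gfin gint gE]] : nu `<< @lebesgue_measure R.
  exact: (uniformly_ac_dominated (F := cF)).
exists (fine \o g).
  by apply: eq_integrable gint => // x _ /=; rewrite fineK.
move=> x y xy; rewrite /Rintegral; have := gE `]x, y]%classic (measurable_itv _).
rewrite [X in X = _](lebesgue_stieltjes_itv cF xy) => e.
under eq_integral do rewrite /= fineK//.
by rewrite -e.
Qed.

(** Composing with the retraction onto [[a, b]] extends a function on this segment to
    the line, and preserves monotonicity and absolute continuity. *)
Definition clamp a b x := Num.max a (Num.min b x).

Lemma clamp_bounds a b x : a <= b -> a <= clamp a b x <= b.
Proof.
by move=> ab; rewrite /clamp le_max lexx/= ge_max ab ge_min lexx.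
Qed.

Lemma clamp_id a b x : a <= x <= b -> clamp a b x = x.
Proof. by case/andP=> ax xb; rewrite /clamp min_r// max_r. Qed.

Lemma clamp_homo a b : {homo clamp a b : x y / x <= y}.
Proof.
move=> x y xy; rewrite /clamp.
by case: (leP b x) => ?; case: (leP b y) => ?; case: (leP a b) => ?;
  case: (leP a x) => ?; case: (leP a y) => ?; lra.
Qed.

Lemma clamp_lip a b x y : x <= y -> clamp a b y - clamp a b x <= y - x.
Proof.
move=> xy; rewrite /clamp.
by case: (leP b x) => ?; case: (leP b y) => ?; case: (leP a b) => ?;
  case: (leP a x) => ?; case: (leP a y) => ?; lra.
Qed.

Lemma clamp_family a b s : a <= b -> interval_family s ->
  let s' := [seq (clamp a b p.1, clamp a b p.2) | p <- s] in
  itv_family a b s' /\ total_length s' <= total_length s.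
Proof.
move=> ab /andP[/allP sp so] /=; split; last first.
  rewrite /total_length big_map big_seq [leRHS]big_seq.
  by apply: ler_sum => p /sp ?; exact: clamp_lip.
apply/andP; split.
  apply/allP => _ /mapP[p /sp p12 ->] /=.
  have /andP[-> _] := clamp_bounds p.1 ab; have /andP[_ ->] := clamp_bounds p.2 ab.
  by rewrite clamp_homo.
rewrite pairwise_map; apply: sub_pairwise so => p q.
by rewrite /nonoverlapping /= => /orP[] /(@clamp_homo a b) ->; rewrite ?orbT.
Qed.

(** The variation is at most 1 on intervals shorter than the modulus of continuity for
    the oscillation 1, and finitely many of these cover [[a, b]]. *)
Lemma ac_bounded_variation a b f : a <= b -> abs_continuous_on a b f ->
  total_variation a b f \is a fin_num.
Proof.
move=> ab /abs_continuous_on_seq/(_ 1 ltr01)[d d0 dP].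
have tv1 l r : a <= l -> l <= r -> r <= b -> r - l < d ->
    (total_variation l r f <= 1%:E)%E.
  move=> al lr rb lrd; have := total_variation_family dP (s := [:: (l, r)]).
  by rewrite big_seq1/= /itv_family/= al lr rb /total_length big_seq1; exact.
pose N := Num.bound ((b - a) / d); pose h := (b - a) / N%:R.
have ba0 : 0 <= (b - a) / d by rewrite divr_ge0 ?subr_ge0// ltW.
have N0 : 0 < N%:R :> R by exact: le_lt_trans ba0 (archi_boundP ba0).
have hd : h < d by rewrite /h ltr_pdivrMr// mulrC -ltr_pdivrMr// archi_boundP.
have h0 : 0 <= h by rewrite divr_ge0 ?subr_ge0// ltW.
have hN : a + h * N%:R = b by rewrite /h divfK ?gt_eqF//; lra.
rewrite ge0_fin_numE; last exact: total_variation_ge0.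
suff H k : (k <= N)%N -> (total_variation a (a + h * k%:R) f <= k%:R%:E)%E.
  by have := H N (leqnn _); rewrite hN => /le_lt_trans; apply; exact: ltry.
elim: k => [_|k ih kN]; first by rewrite mulr0 addr0 total_variationxx.
have hk : 0 <= h * k%:R by rewrite mulr_ge0.
have hkN : h * k.+1%:R <= h * N%:R by rewrite ler_wpM2l// ler_nat.
have hkk : h * k.+1%:R = h * k%:R + h by rewrite -natr1 mulrDr mulr1.
rewrite (@total_variationD _ a _ (a + h * k%:R)); [|lra..].
rewrite -natr1 EFinD leeD//; first exact/ih/ltnW.
by apply: tv1; lra.
Qed.

End Densities.

(** * Differentiation of absolutely continuous functions *)

Section Differentiation.
Context {R : realType}.
Implicit Types (a b x y : R) (f F : R -> R) (s t : seq (R * R)).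

Local Notation mu := (@lebesgue_measure R).

Lemma ae_imply (P Q : R -> Prop) : (forall x, P x -> Q x) ->
  {ae mu, forall x, P x} -> {ae mu, forall x, Q x}.
Proof. by move=> PQ; apply: filterS => //; exact: (ae_filter_ringOfSetsType mu). Qed.

Lemma ae_imply2 (P Q S : R -> Prop) : (forall x, P x -> Q x -> S x) ->
  {ae mu, forall x, P x} -> {ae mu, forall x, Q x} -> {ae mu, forall x, S x}.
Proof. by move=> PQ; apply: filterS2 => //; exact: (ae_filter_ringOfSetsType mu). Qed.

Lemma ae_and (P Q : R -> Prop) : {ae mu, forall x, P x} ->
  {ae mu, forall x, Q x} -> {ae mu, forall x, P x /\ Q x}.
Proof. exact: ae_imply2. Qed.

(** Stated for an abstract [F], which is an integral depending on its upper bound in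
    the applications. *)
Lemma is_derive_congr a b F f (k l : R) x : a < x < b ->
  (forall y, a < y < b -> f y = F y + k) ->
  derivable F x 1 -> derive1 F x = l -> is_derive x 1 f l.
Proof.
move=> /andP[ax xb] fF dF F'.
apply: (@near_eq_is_derive _ _ _ (fun y => F y + k)).
  near=> y; rewrite -fF//; apply/andP; split; near: y.
    exact: lt_nbhsr.
  exact: lt_nbhsl.
rewrite -[l]addr0; apply: is_deriveD; apply: DeriveDef => //.
by rewrite -derive1E.
Unshelve. all: by end_near. Qed.

Lemma total_variation_fin a b x y f : a <= x -> x <= y -> y <= b ->
  total_variation a b f \is a fin_num -> total_variation x y f \is a fin_num.
Proof.
move=> ax xy yb; rewrite !ge0_fin_numE ?total_variation_ge0 ?(le_trans ax) ?(le_trans xy)//.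
apply: le_lt_trans; rewrite (@total_variationD _ a b x)//; last exact: le_trans yb.
rewrite (@total_variationD _ x b y)// addeCA leeDl// adde_ge0 ?total_variation_ge0//.
Qed.

(** Jordan decomposition: the variation of [f] and the variation minus [f] are
    both nondecreasing and absolutely continuous, so each has a density. *)
Lemma ac_density a b f : a <= b -> abs_continuous_on a b f ->
  exists2 g : R -> R, mu.-integrable setT (EFin \o g) &
    forall x, a <= x <= b -> f x - f a = \int[mu]_(t in `[a, x]) g t.
Proof.
move=> ab acf; have tvfin := ac_bounded_variation ab acf.
pose T x := fine (total_variation a (clamp a b x) f).
pose G x := T x - f (clamp a b x).
have cl x := clamp_bounds x ab.
have TB x y : x <= y -> (T y - T x)%:E = total_variation (clamp a b x) (clamp a b y) f.
  move=> xy; have /andP[ax xb] := cl x; have /andP[ay yb] := cl y.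
  have cxy := clamp_homo a b xy.
  rewrite EFinB /T !fineK; [|exact: (total_variation_fin _ _ _ tvfin)..].
  rewrite (@total_variationD _ a _ (clamp a b x))// addeAC subee ?add0e//.
  exact: (total_variation_fin _ _ _ tvfin).
have fT x y : x <= y -> `|f (clamp a b y) - f (clamp a b x)| <= T y - T x.
  by move=> xy; rewrite -lee_fin TB// total_variation_ge// clamp_homo.
have ndT : {homo T : x y / x <= y}.
  by move=> x y /fT h; rewrite -subr_ge0 (le_trans _ h).
have ndG : {homo G : x y / x <= y}.
  by move=> x y /fT; rewrite ler_norml /G => /andP[_ ]; lra.
have acT : uniformly_ac T.
  move=> e e0; have [d d0 dP] := abs_continuous_on_seq acf e0.
  exists d => // s sfam sd; have [s'fam s'd] := clamp_family ab sfam.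
  have := total_variation_family dP s'fam (le_lt_trans s'd sd).
  rewrite big_map -lee_fin; apply: le_trans.
  rewrite /oscillation -sumEFin big_seq [leRHS]big_seq.
  have /andP[/allP sp _] := sfam.
  apply: lee_sum => p /sp p12; rewrite /= -TB// lee_fin ger0_norm// subr_ge0.
  exact: ndT.
have acG : uniformly_ac G.
  move=> e e0; have [d d0 dP] := acT _ (divr_gt0 e0 (ltr0n _ 2)).
  exists d => // s sfam sd; have {dP} := dP _ sfam sd; have /andP[/allP sp _] := sfam.
  rewrite ler_pdivlMr// mulr_natr; apply: le_trans.
  rewrite /oscillation mulr2n -big_split /= big_seq [leRHS]big_seq.
  apply: ler_sum => p /sp p12; have := fT _ _ p12.
  have TT : 0 <= T p.2 - T p.1 by rewrite subr_ge0 ndT.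
  rewrite (ger0_norm TT) !ler_norml /G; lra.
have TM x : 0 <= T x <= fine (total_variation a b f).
  have /andP[ax xb] := cl x; apply/andP; split.
    by rewrite fine_ge0// total_variation_ge0.
  rewrite fine_le//; first exact: (total_variation_fin _ _ _ tvfin).
  by rewrite (@total_variationD _ a b (clamp a b x))// leeDl// total_variation_ge0.
have bT x : `|T x| <= fine (total_variation a b f).
  by have /andP[T0 Tb] := TM x; rewrite ger0_norm.
have Ta x : `|f (clamp a b x) - f a| <= T x.
  have /andP[ax xb] := cl x.
  rewrite -lee_fin fineK; last exact: (total_variation_fin _ _ _ tvfin).
  exact: total_variation_ge.
have bG x : `|G x| <= 2 * fine (total_variation a b f) + `|f a|.
  rewrite /G (_ : _ - _ = T x - (f (clamp a b x) - f a) - f a); last by ring.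
  rewrite (le_trans (ler_normB _ _))// lerD2r.
  rewrite (le_trans (ler_normB _ _))//; have := Ta x; have := bT x.
  have /andP[_] := TM x; lra.
have [gT iT gTE] := uniformly_ac_density ndT acT bT.
have [gG iG gGE] := uniformly_ac_density ndG acG bG.
exists (gT \- gG); first by apply: integrableB iT iG.
move=> x /andP[ax xb].
rewrite -Rintegral_itv_obnd_cbnd; last first.
  by apply: (integrableS measurableT) => //; exact: integrableB iT iG.
rewrite RintegralB//; [|exact: (integrableS measurableT)..].
rewrite -gTE// -gGE// /G !clamp_id ?ax ?lexx//; ring.
Qed.

(** The derivative exists and equals the density at every Lebesgue point of the
    density. *)
Lemma ac_ae_derive a b f : a <= b -> abs_continuous_on a b f ->
  exists g : R -> R, [/\ mu.-integrable setT (EFin \o g),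
    (forall x, a <= x <= b -> f x - f a = \int[mu]_(t in `[a, x]) g t) &
    {ae mu, forall x, a < x < b -> is_derive x 1 f (g x)}].
Proof.
move=> ab /(ac_density ab)[g ig gE]; exists g; split => //.
have ia y : mu.-integrable [set` Interval (BLeft a) (BRight y)] (EFin \o g).
  exact: (integrableS measurableT).
have := FTC1 ia (open_integrable_locally openT ig).
apply: ae_imply => x xP /andP[ax xb].
have [dF F'] := xP ax.
apply: (is_derive_congr (a := a) (b := b) (k := f a) _ _ dF F').
  by rewrite ax xb.
by move=> y /andP[ay yb]; rewrite -gE ?subrK// !ltW.
Qed.

Lemma ae_itv_cover (P : R -> Prop) :
  (forall n : nat, {ae mu, forall x, - n%:R < x < n%:R -> P x}) -> {ae mu, forall x, P x}.
Proof.
move=> /ae_foralln; apply: ae_imply => x xP.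
by apply: (xP (Num.bound `|x|)); rewrite -ltr_norml archi_boundP.
Qed.

Lemma AC_loc_ae_derivable f : AC_loc f -> {ae mu, forall x, derivable f x 1}.
Proof.
move=> acf; apply: ae_itv_cover => n.
have [g [_ _]] := ac_ae_derive (ge0_cp (ler0n R n)).2 (acf _ _).
by apply: ae_imply => x xP /xP [].
Qed.

(** The density of [f] agrees almost everywhere with [h], so that [f] is locally an
    integral of the continuous function [h]. *)
Lemma AC_loc_is_derive f (h : R -> R) : AC_loc f -> continuous h ->
  {ae mu, forall x, derive1 f x = h x} -> forall x, is_derive x 1 f (h x).
Proof.
move=> acf ch fh x.
have xx : x - 1 <= x + 1 by lra.
have [g [ig gE gd]] := ac_ae_derive xx (acf _ _).
have ih : mu.-integrable `[x - 1, x + 1] (EFin \o h).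
  by apply: continuous_compact_integrable; [exact: segment_compact|exact: continuous_subspaceT].
have hE y : x - 1 <= y < x + 1 -> f y = \int[mu]_(t in `[x - 1, y]) h t + f (x - 1).
  move=> /andP[y1 y2]; rewrite -[LHS](subrK (f (x - 1))) gE ?y1 ?(ltW y2)//.
  congr (_ + _); rewrite -!Rintegral_itv_obnd_cbnd; last 2 first.
    by apply: integrableS ih => //; apply: subset_itv; rewrite bnd_simp// ltW.
    exact: (integrableS measurableT).
  rewrite /Rintegral; congr fine; apply: ae_eq_integral => //.
  - by apply: measurable_int; apply: (integrableS measurableT) ig.
  - apply: measurable_int; apply: integrableS ih => //; apply: subset_itv.
      by rewrite bnd_simp.
    by rewrite bnd_simp ltW.
  - apply: ae_imply2 gd fh => t gt ht /=; rewrite in_itv/= => /andP[t1 t2].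
    have td : is_derive t 1 f (g t) by apply: gt; rewrite t1 (le_lt_trans t2).
    by rewrite -ht derive1E derive_val.
have [dF F'] := @continuous_FTC1_closed _ h (x - 1) x (x + 1) ltac:(lra) ih ltac:(lra) (ch x).
apply: (is_derive_congr (a := x - 1) (b := x + 1) (k := f (x - 1)) _ _ dF F').
  by apply/andP; split; lra.
by move=> y /andP[y1 y2]; apply: hE; rewrite y2 ltW.
Qed.

End Differentiation.

(** * Operations on absolutely continuous functions and primitives *)

Section Primitives.
Context {R : realType}.
Implicit Types (a b x y : R) (f F : R -> R) (s t : seq (R * R)).

Local Notation mu := (@lebesgue_measure R).

Lemma continuous_itv_bounded a b f : continuous f ->
  exists2 M, 0 < M & forall x, a <= x <= b -> `|f x| <= M.
Proof.
move=> cf; have [ab|ba] := leP a b; last first.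
  by exists 1 => // x /andP[ax xb]; move: (le_trans ax xb); rewrite leNgt ba.
have [c _ cP] := @EVT_max R (fun x => `|f x|) a b ab
  (continuous_subspaceT (fun x => continuous_comp (cf x) (@norm_continuous _ _ _))).
exists (`|f c| + 1) => [|x xab]; first by rewrite ltr_wpDl.
by rewrite (le_trans (cP x _))// ?in_itv// lerDl.
Qed.

Lemma AC_loc_continuous f : AC_loc f -> continuous f.
Proof.
move=> acf x; apply/cvgrPdist_lt => e e0.
have [d d0 dP] := acf (x - 1) (x + 1) e e0.
have fam p q : x - 1 <= p -> p <= q -> q <= x + 1 -> q - p < d -> `|f q - f p| < e.
  move=> xp pq qx pqd; have := dP 1%N (fun=> p) (fun=> q).
  rewrite !big_ord1; apply => //.
  by move=> i j _ _ _; rewrite !ord1.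
near=> y.
have yd : `|x - y| < d by near: y; apply: (@cvgr_dist_lt _ R^o) => //; exact: cvg_id.
have : `|x - y| < 1 by near: y; apply: (@cvgr_dist_lt _ R^o) => //; exact: cvg_id.
rewrite ltr_norml => /andP[y1 y2].
move: yd; rewrite ltr_norml => /andP[y3 y4].
have [xy|/ltW yx] := leP x y; last by apply: fam; lra.
by rewrite distrC; apply: fam; lra.
Unshelve. all: by end_near. Qed.

Lemma AC_loc_lipschitz f : (forall a b, exists2 M, 0 < M & forall x y,
    a <= x -> x <= y -> y <= b -> `|f y - f x| <= M * (y - x)) ->
  AC_loc f.
Proof.
move=> lf a b e e0; have [M M0 Mf] := lf a b.
exists (e / M); first by rewrite divr_gt0.
move=> n l r lr _; rewrite ltr_pdivlMr// mulrC; apply: le_lt_trans.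
by rewrite mulr_sumr; apply: ler_sum => i _; have [? ? ?] := lr i; exact: Mf.
Qed.

Lemma AC_loc_C1 f (df : R -> R) : (forall x, is_derive x 1 f (df x)) ->
  continuous df -> AC_loc f.
Proof.
move=> fdf cdf; apply: AC_loc_lipschitz => a b.
have [M M0 Mdf] := continuous_itv_bounded a b cdf; exists M => // x y ax xy yb.
have cf : continuous f.
  move=> z; apply: differentiable_continuous; apply/derivable1_diffP.
  by have [] := fdf z.
have [z] := MVT_segment xy (fun z _ => fdf z) (continuous_subspaceT cf).
rewrite in_itv/= => /andP[xz zy] ->.
rewrite normrM (ger0_norm (_ : 0 <= y - x)) ?subr_ge0// ler_wpM2r ?subr_ge0//.
by apply: Mdf; rewrite (le_trans ax)// (le_trans zy).
Qed.

Lemma AC_loc_cst c : AC_loc (fun=> c : R).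
Proof.
apply: AC_loc_lipschitz => a b; exists 1 => // x y _ xy _.
by rewrite subrr normr0 mul1r subr_ge0.
Qed.

Lemma AC_locD f F : AC_loc f -> AC_loc F -> AC_loc (fun x => f x + F x).
Proof.
move=> acf acF a b e e0; have e20 : 0 < e / 2 by rewrite divr_gt0.
have [d1 d10 dP1] := acf a b _ e20; have [d2 d20 dP2] := acF a b _ e20.
exists (Num.min d1 d2); first by rewrite lt_min d10.
move=> n l r lr tlr; rewrite lt_min => /andP[/(dP1 _ _ _ lr tlr) h1 /(dP2 _ _ _ lr tlr) h2].
have := ltrD h1 h2; rewrite -splitr; apply: le_lt_trans; rewrite -big_split/=.
by apply: ler_sum => i _; rewrite opprD addrACA ler_normD.
Qed.

Lemma AC_locM f F : AC_loc f -> AC_loc F -> AC_loc (fun x => f x * F x).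
Proof.
move=> acf acF a b e e0.
have [M1 M10 MP1] := continuous_itv_bounded a b (AC_loc_continuous acf).
have [M2 M20 MP2] := continuous_itv_bounded a b (AC_loc_continuous acF).
have e1 : 0 < e / 2 / M2 by rewrite !divr_gt0.
have e2 : 0 < e / 2 / M1 by rewrite !divr_gt0.
have [d1 d10 dP1] := acf a b _ e1; have [d2 d20 dP2] := acF a b _ e2.
exists (Num.min d1 d2); first by rewrite lt_min d10.
move=> n l r lr tlr; rewrite lt_min => /andP[/(dP1 _ _ _ lr tlr) + /(dP2 _ _ _ lr tlr)].
rewrite ltr_pdivlMr// => h1; rewrite ltr_pdivlMr// => h2.
have := ltrD h1 h2; rewrite -splitr; apply: le_lt_trans; rewrite !mulr_suml -big_split/=.
apply: ler_sum => i _; have [al lri rb] := lr i.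
rewrite (_ : _ - _ = (f (r i) - f (l i)) * F (r i) + (F (r i) - F (l i)) * f (l i)); last ring.
rewrite (le_trans (ler_normD _ _))// !normrM lerD// ler_wpM2l//.
  by apply: MP2; rewrite rb andbT (le_trans al).
by apply: MP1; rewrite al (le_trans lri).
Qed.

Lemma AC_locZ c f : AC_loc f -> AC_loc (fun x => c * f x).
Proof. by move=> acf; apply: AC_locM => //; exact: AC_loc_cst. Qed.

Lemma AC_locB f F : AC_loc f -> AC_loc F -> AC_loc (fun x => f x - F x).
Proof.
move=> acf acF; rewrite (_ : (fun x => _) = (fun x => f x + -1 * F x)).
  by apply: AC_locD => //; exact: AC_locZ.
by apply/funext => x; rewrite mulN1r.
Qed.

Section Primitive.
Variable V : R -> R.
Hypothesis V_loc : locally_integrable setT V.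

Lemma locally_integrable_itv (i : interval R) a b :
  [set` i] `<=` `[a, b] -> mu.-integrable [set` i] (EFin \o V).
Proof.
move=> iab; have [mV _ iV] := V_loc.
have ab : mu.-integrable `[a, b] (EFin \o V).
  apply/integrableP; split; first exact/measurable_EFinP/measurable_funTS.
  by apply: iV => //; exact: segment_compact.
exact: integrableS ab.
Qed.

(** The integral from 0 to [x] for both signs of [x]: one of the two integrals is
    always zero. *)
Definition primitive x :=
  \int[mu]_(t in `[0, x]) V t - \int[mu]_(t in `[x, 0]) V t.

Lemma primitiveE a x : a <= 0 -> a <= x ->
  primitive x = \int[mu]_(t in `[a, x]) V t - \int[mu]_(t in `[a, 0]) V t.
Proof.
move=> a0 ax; rewrite /primitive; have [x0|x0] := leP 0 x.
  rewrite (@Rintegral_itvB _ V (BLeft a) (BRight x) 0) ?bnd_simp//; last first.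
    exact: (@locally_integrable_itv _ a x).
  rewrite Rintegral_itv_obnd_cbnd; last first.
    by apply: (@locally_integrable_itv _ 0 x); apply: subset_itv; rewrite bnd_simp.
  move: x0; rewrite le_eqVlt => /predU1P[<-|x0].
    by rewrite set_itv1 Rintegral_set1 subr0.
  by rewrite [in X in _ - X]set_itv_ge ?bnd_simp -?ltNge// Rintegral_set0 subr0.
rewrite -(opprB (\int[mu]_(t in `[a, 0]) V t)).
rewrite (@Rintegral_itvB _ V (BLeft a) (BRight 0) x) ?bnd_simp//;
  [|exact: (@locally_integrable_itv _ a 0)|exact: ltW].
rewrite Rintegral_itv_obnd_cbnd; last first.
  by apply: (@locally_integrable_itv _ x 0); apply: subset_itv; rewrite bnd_simp.
by rewrite [in X in X - _]set_itv_ge ?bnd_simp -?ltNge// Rintegral_set0 sub0r.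
Qed.

Lemma primitiveB a x : a <= x ->
  primitive x - primitive a = \int[mu]_(t in `]a, x]) V t.
Proof.
move=> ax; pose m := Num.min a 0.
have ma : m <= a by rewrite ge_min lexx.
have m0 : m <= 0 by rewrite ge_min lexx orbT.
rewrite !(@primitiveE m)// ?(le_trans ma)// opprB addrA subrK.
by apply: Rintegral_itvB; rewrite ?bnd_simp//; exact: (@locally_integrable_itv _ m x).
Qed.

Lemma le_primitiveB a x : a <= x ->
  (`|primitive x - primitive a|%:E <= \int[mu]_(t in `]a, x[) `|V t|%:E)%E.
Proof.
move=> ax; have iV (b1 b2 : bool) :
    mu.-integrable [set` Interval (BSide b1 a) (BSide b2 x)] (EFin \o V).
  apply: (@locally_integrable_itv _ a x); apply: subset_itv; rewrite bnd_simp.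
    by case: b1.
  by case: b2.
rewrite primitiveB// -Rintegral_itv_bndo_bndc// EFin_normr_Rintegral//.
apply: le_abse_integral => //; exact: measurable_int (iV false true).
Qed.

(** The increments of the primitive over disjoint intervals are bounded by the integral
    of [`|V|] over their union, which is small when the union is. *)
Lemma AC_loc_primitive : AC_loc primitive.
Proof.
move=> a b e e0.
have [mV _ _] := V_loc.
have [d [d0 dP]] : exists d : R, 0 < d /\ forall A, measurable A ->
    (mu A < d%:E)%E -> \int[mu]_(x in A) `|(V \_ `[a, b]) x| < e.
  apply: integral_normr_continuous => //.
  by rewrite -restrict_EFin; apply/integrable_restrict => //=; rewrite setTI;
    exact: (@locally_integrable_itv _ a b).
exists d => // n l r lr tlr lrd.
pose A := \big[setU/set0]_(i < n) `]l i, r i[%classic.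
have mA : measurable A by apply: bigsetU_measurable => i _; exact: measurable_itv.
have muA : mu A = (\sum_i (r i - l i))%:E.
  rewrite /A measure_bigsetU_ord//= -sumEFin; apply: eq_bigr => i _.
  have [_ lri _] := lr i; rewrite lebesgue_measure_itv/= lte_fin.
  by move: lri; rewrite le_eqVlt => /predU1P[->|->]; rewrite ?ltxx ?subrr.
apply: le_lt_trans (dP A mA _); last by rewrite muA lte_fin.
have Aab : A `<=` `[a, b].
  rewrite /A; elim/big_ind : _ => [x []//|X Y hX hY x [/hX|/hY]//|i _ x /=].
  have [al _ rb] := lr i; rewrite !in_itv/= => /andP[lx xr].
  by rewrite (le_trans al (ltW lx)) (le_trans (ltW xr)).
have iVA : mu.-integrable A (EFin \o V).
  have iab : mu.-integrable `[a, b] (EFin \o V) by exact: (@locally_integrable_itv _ a b).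
  exact: integrableS iab.
have -> : \int[mu]_(x in A) `|(V \_ `[a, b]) x| = \int[mu]_(x in A) `|V x|.
  by apply: eq_Rintegral => x xA; rewrite patchE mem_set//; exact/Aab/set_mem.
rewrite -lee_fin fineK; last first.
  apply: integrable_fin_num => //. exact: (integrable_norm iVA).
rewrite /A ge0_integral_bigsetU//; last 3 first.
- by apply: index_enum_uniq.
- exact: sub_trivIset tlr.
- by apply/measurable_EFinP/measurableT_comp => //; exact: measurable_funTS.
rewrite -sumEFin; apply: lee_sum => i _; apply: le_primitiveB.
by have [] := lr i.
Qed.

Lemma ae_derive_primitive : {ae mu, forall x, is_derive x 1 primitive (V x)}.
Proof.
apply: ae_itv_cover => n.
have n0 : - n%:R <= 0 :> R by rewrite oppr_le0.
have iV y : mu.-integrable [set` Interval (BLeft (- n%:R)) (BRight y)] (EFin \o V).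
  exact: (@locally_integrable_itv _ (- n%:R) y).
have := FTC1 iV V_loc.
apply: ae_imply => x xP /andP[nx xn]; have [dF F'] := xP nx.
apply: (is_derive_congr (a := - n%:R) (b := x + 1)
  (k := - \int[mu]_(t in `[- n%:R, 0]) V t) _ _ dF F').
  by rewrite nx ltrDl ltr01.
by move=> y /andP[ny _]; rewrite -primitiveE// ltW.
Qed.

End Primitive.

Lemma continuous_locally_integrable f : continuous f -> locally_integrable setT f.
Proof.
move=> cf; split; [exact: continuous_measurable_fun|exact: openT|move=> K _ cK].
have /integrableP[] // : mu.-integrable K (EFin \o f).
by apply: continuous_compact_integrable => //; exact: continuous_subspaceT.
Qed.

Lemma is_derive_primitive f : continuous f ->
  forall x, is_derive x 1 (primitive f) (f x).
Proof.
move=> cf; have lf := continuous_locally_integrable cf.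
apply: AC_loc_is_derive => //; first exact: AC_loc_primitive.
apply: ae_imply (ae_derive_primitive lf) => x fx.
by rewrite derive1E derive_val.
Qed.

End Primitives.

(** * Decay of square integrable solutions of hyperbolic systems *)

Section Decay.
Context {R : realType}.
Implicit Types (a b x y : R) (f F : R -> R) (s t : seq (R * R)).

Lemma is_derive_add f F df dF x : is_derive x 1 f df -> is_derive x 1 F dF ->
  is_derive x 1 (fun y => f y + F y) (df + dF).
Proof. by move=> ? ?; exact: is_deriveD. Qed.

Lemma is_derive_sub f F df dF x : is_derive x 1 f df -> is_derive x 1 F dF ->
  is_derive x 1 (fun y => f y - F y) (df - dF).
Proof. by move=> ? ?; exact: is_deriveB. Qed.

Lemma is_derive_mul f F df dF x : is_derive x 1 f df -> is_derive x 1 F dF ->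
  is_derive x 1 (fun y => f y * F y) (df * F x + f x * dF).
Proof.
move=> ? ?; apply: (is_derive_eq (is_deriveM _ _)).
by rewrite addrC /GRing.scale/= [F x * _]mulrC.
Qed.

Lemma is_derive_scale c f df x : is_derive x 1 f df ->
  is_derive x 1 (fun y => c * f y) (c * df).
Proof. by move=> ?; exact: is_deriveZ. Qed.

Lemma is_derive_expRM (k x : R) :
  is_derive x 1 (fun y => expR (k * y)) (k * expR (k * x)).
Proof.
have h : is_derive x 1 (fun y => k * y) (k * 1) by exact: is_derive_scale.
apply: (is_derive_eq (is_derive1_comp (is_derive_expR _) h)).
by rewrite mulr1 mulrC.
Qed.

Lemma is_derive_continuous f (df : R -> R) :
  (forall x, is_derive x 1 f (df x)) -> continuous f.
Proof.
move=> fdf x; apply: differentiable_continuous; apply/derivable1_diffP.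
by have [] := fdf x.
Qed.

Lemma derive_ge0_le f (df : R -> R) a : (forall x, is_derive x 1 f (df x)) ->
  (forall x, a <= x -> 0 <= df x) -> forall x y, a <= x -> x <= y -> f x <= f y.
Proof.
move=> fdf df0 x y ax xy.
have cf := is_derive_continuous fdf.
have [z] := MVT_segment xy (fun z _ => fdf z) (continuous_subspaceT cf).
rewrite in_itv/= => /andP[xz zy] e; rewrite -subr_ge0 e mulr_ge0 ?subr_ge0//.
by apply: df0; exact: le_trans xz.
Qed.

Definition exp_decay (k : R) f :=
  exists C : R, forall x, `|f x| <= C * expR (- (k * `|x|)).

Definition exp_decay_pinfty (k : R) f :=
  exists C : R, forall x, 0 <= x -> `|f x| <= C * expR (- (k * x)).

Lemma exp_decay_pinfty_eventually (k : R) a C f : continuous f ->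
  (forall x, a <= x -> `|f x| <= C * expR (- (k * x))) -> exp_decay_pinfty k f.
Proof.
move=> cf fa.
have cg : continuous (fun x => f x * expR (k * x)).
  move=> x; apply: cvgM; first exact: cf.
  exact: (is_derive_continuous (is_derive_expRM k)).
have [M M0 MP] := continuous_itv_bounded 0 a cg.
exists (Num.max M C) => x x0; have [xa|ax] := leP x a; last first.
  rewrite (le_trans (fa x (ltW ax)))// ler_wpM2r ?expR_ge0//.
  by rewrite le_max lexx orbT.
have := MP x; rewrite x0 xa => /(_ isT).
rewrite normrM (ger0_norm (expR_ge0 _)) expRN ler_pdivlMr ?expR_gt0//.
by move=> h; rewrite (le_trans h)// le_max lexx.
Qed.

(** Square integrable solutions of a planar system that tends to
    [w' = u], [u' = k^2 w] decay at every rate smaller than [k]: the product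
    [w u] is nondecreasing; were it ever positive, [w^2] would grow at least
    linearly; once [w u <= 0], the component [u - k w] controls the solution and
    contracts at a rate close to [k]. *)
Section HyperbolicSystem.
Variables (k : R) (w u p q S : R -> R) (K : R).
Hypothesis k_gt0 : 0 < k.
Hypothesis dw : forall x, is_derive x 1 w (u x + p x * w x).
Hypothesis du : forall x, is_derive x 1 u ((k ^+ 2 + q x) * w x - p x * u x).
Hypothesis cdw : continuous (fun x => u x + p x * w x).
Hypothesis dS : forall x, is_derive x 1 S (w x ^+ 2).
Hypothesis S_bounded : forall x y, x <= y -> S y - S x <= K.
Hypothesis pq_small : forall e, 0 < e -> exists a, forall x, a <= x ->
  `|p x| <= e /\ `|q x| <= e.

Let dwu x : is_derive x 1 (fun y => w y * u y)
  (u x ^+ 2 + (k ^+ 2 + q x) * w x ^+ 2).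
Proof.
apply: (is_derive_eq (is_derive_mul (dw x) (du x))); ring.
Qed.

(* A positive value [c] of [w u] at [x] gives [(w^2)' >= 2 c - 2 w^2] from [x] on. As the
   primitive [S] of [w^2] is bounded, [w^2] is at least 1 beyond the point [y], and then
   [S] is not bounded. *)
Let wu_le0 : exists a, forall x, a <= x -> w x * u x <= 0.
Proof.
have k2 : 0 < k ^+ 2 by rewrite exprn_gt0.
have [a aP] := pq_small k2.
have [b bP] := pq_small ltr01.
exists (Num.max a b) => x; rewrite ge_max => /andP[ax bx].
rewrite leNgt; apply/negP => c0; set c := w x * u x in c0.
have wu_ge y : x <= y -> c <= w y * u y.
  apply: (derive_ge0_le dwu) => // z xz.
  have [_] := aP z (le_trans ax xz); rewrite ler_norml => /andP[qz _].
  by rewrite addr_ge0 ?sqr_ge0// mulr_ge0 ?sqr_ge0//; lra.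
have dG y : is_derive y 1 (fun y => w y * w y + 2 * S y - 2 * c * y)
    ((u y + p y * w y) * w y + w y * (u y + p y * w y) + 2 * w y ^+ 2 - 2 * c * 1).
  apply: is_derive_sub; apply: is_derive_add.
  exact: is_derive_mul.
have Gge y : x <= y -> w x * w x + 2 * S x - 2 * c * x <= w y * w y + 2 * S y - 2 * c * y.
  apply: (derive_ge0_le dG) => // z xz.
  have [] := bP z (le_trans bx xz); rewrite ler_norml => /andP[pz _] _.
  have := wu_ge z xz; have : 0 <= (1 + p z) * (w z) ^+ 2.
    by rewrite mulr_ge0 ?sqr_ge0//; lra.
  nra.
pose y := x + (1 + 2 * `|K|) / (2 * c).
have xy : x <= y.
  by rewrite lerDl; apply: divr_ge0; have := normr_ge0 K; lra.
have w1 z : y <= z -> 1 <= w z ^+ 2.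
  move=> yz; have := Gge z (le_trans xy yz).
  have := S_bounded (le_trans xy yz); have := ler_norm K.
  have : 2 * c * z >= 2 * c * x + (1 + 2 * `|K|).
    have -> : 2 * c * x + (1 + 2 * `|K|) = 2 * c * y.
      by rewrite /y; field; rewrite gt_eqF.
    by rewrite ler_wpM2l// mulr_ge0// ltW.
  have : 0 <= w x * w x by exact: sqr_ge0.
  nra.
have dH (z : R) : is_derive z 1 (fun z => S z - z) (w z ^+ 2 - 1) by exact: is_derive_sub.
have dH0 z : y <= z -> 0 <= w z ^+ 2 - 1 by move=> /w1; lra.
have K0 := normr_ge0 K; have K1 := ler_norm K.
have yz : y <= y + `|K| + 1 by lra.
have := derive_ge0_le dH dH0 (lexx y) yz.
have := S_bounded yz; lra.
Qed.

Lemma hyperbolic_decay (l : R) : l < k ->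
  exp_decay_pinfty l w /\ exp_decay_pinfty l (fun x => u x + p x * w x).
Proof.
move=> lk.
have [a aP] := wu_le0.
(* With coefficients below [e], the error terms in [(m^2)'] are at most
   [2 (k - l) m^2]. *)
pose e := (k - l) / (k^-1 + 2).
have kV : 0 < k^-1 by rewrite invr_gt0.
have e0 : 0 < e by rewrite divr_gt0//; lra.
have [b bP] := pq_small e0; have [b1 b1P] := pq_small ltr01.
pose m x := u x - k * w x.
have dm x : is_derive x 1 m ((k ^+ 2 + q x) * w x - p x * u x - k * (u x + p x * w x)).
  by apply: is_derive_sub => //; exact: is_derive_scale.
pose d := Num.max a (Num.max b b1).
have mE x : d <= x -> `|u x| <= `|m x| /\ `|w x| <= k^-1 * `|m x|.
  rewrite /d !ge_max => /and3P[/aP wu _ _].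
  have kwu : 0 <= k * - (w x * u x) by rewrite mulr_ge0 ?(ltW k_gt0)// oppr_ge0.
  have mm : m x ^+ 2 = u x ^+ 2 + (k * w x) ^+ 2 + 2 * (k * - (w x * u x)).
    by rewrite /m; ring.
  have := sqr_ge0 (u x); have := sqr_ge0 (k * w x) => h1 h2; split.
    by rewrite -ler_sqr ?nnegrE// !real_normK ?num_real// mm; lra.
  rewrite -(ler_pM2l k_gt0) mulrA divff ?gt_eqF// mul1r -{1}(gtr0_norm k_gt0) -normrM.
  by rewrite -ler_sqr ?nnegrE// !real_normK ?num_real// mm; lra.
(* The derivative of [- exp (2 l x) m^2]. *)
pose dF x := - ((2 * l) * expR ((2 * l) * x) * (m x * m x) + expR ((2 * l) * x) *
  (((k ^+ 2 + q x) * w x - p x * u x - k * (u x + p x * w x)) * m x + m x *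
  ((k ^+ 2 + q x) * w x - p x * u x - k * (u x + p x * w x)))).
have dFP x : is_derive x 1 (fun x => - (expR ((2 * l) * x) * (m x * m x))) (dF x).
  apply: is_deriveN; apply: is_derive_mul; first exact: is_derive_expRM.
  exact: is_derive_mul.
have dF0 x : d <= x -> 0 <= dF x.
  move=> dx; have [um wm] := mE x dx; move: dx; rewrite /d !ge_max => /and3P[_ /bP[pe qe] _].
  have -> : dF x = expR (2 * l * x) * (2 * ((k - l) * `|m x| ^+ 2 -
      m x * ((q x - k * p x) * w x - p x * u x))).
    rewrite /dF real_normK ?num_real// /m; ring.
  rewrite mulr_ge0 ?expR_ge0// mulr_ge0// subr_ge0.
  rewrite (le_trans (ler_norm _))// normrM expr2 mulrA [_ * `|m x|]mulrC ler_wpM2l//.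
  rewrite (le_trans (ler_normB _ _))// !normrM.
  have -> : (k - l) = (e + k * e) * k^-1 + e.
    rewrite mulrDl -[k * e]mulrC mulfK ?gt_eqF// -addrA -mulr2n -mulr_natr -mulrDr.
    by rewrite divfK// gt_eqF//; lra.
  rewrite mulrDl lerD//; last by rewrite ler_pM.
  rewrite -mulrA ler_pM//.
  by rewrite (le_trans (ler_normB _ _))// lerD// normrM gtr0_norm// ler_wpM2l// ltW.
pose C := Num.sqrt (expR (2 * l * d) * (m d * m d)).
have mC x : d <= x -> `|m x| <= C * expR (- (l * x)).
  move=> dx; have := derive_ge0_le dFP dF0 (lexx d) dx; rewrite lerN2 => h.
  rewrite expRN ler_pdivlMr ?expR_gt0// -[expR (l * x)]ger0_norm ?expR_ge0// -normrM.
  rewrite -sqrtr_sqr ler_wsqrtr// exprMn -expRM_natl.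
  by rewrite mulrA mulrC expr2.
have cw := is_derive_continuous dw.
split.
  apply: (@exp_decay_pinfty_eventually _ d (k^-1 * C)) => // x dx.
  have [_ wm] := mE x dx.
  by rewrite (le_trans wm)// -mulrA ler_wpM2l ?mC// ltW.
apply: (@exp_decay_pinfty_eventually _ d ((1 + k^-1) * C)) => // x dx.
have [um wm] := mE x dx.
apply: (@le_trans _ _ ((1 + k^-1) * `|m x|)); last first.
  by rewrite -mulrA ler_wpM2l ?mC// addr_ge0// ltW.
rewrite mulrDl mul1r (le_trans (ler_normD _ _))// lerD// normrM.
move: dx; rewrite /d !ge_max => /and3P[_ _ /b1P[p1 _]].
by rewrite (le_trans _ wm)// ler_piMl.
Qed.
End HyperbolicSystem.

End Decay.

(** * Regularization of the potential *)

Section Regularization.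
Context {R : realType}.
Implicit Types (a b x y : R) (f F : R -> R) (s t : seq (R * R)).

Local Notation mu := (@lebesgue_measure R).

Lemma is_derive_reflect f (df : R) x : is_derive (- x) 1 f df ->
  is_derive x 1 (fun y => f (- y)) (- df).
Proof.
move=> fdf; have h : is_derive x 1 (fun y : R => - y) (- 1) by exact: is_deriveN.
apply: (is_derive_eq (is_derive1_comp (f := f) _ h)).
by rewrite mulrN1.
Qed.

Lemma is_derive_translate f (df : R -> R) c x : (forall y, is_derive y 1 f (df y)) ->
  is_derive x 1 (fun y => f (y + c)) (df (x + c)).
Proof.
move=> fdf; have h : is_derive x 1 (fun y : R => y + c) (1 + 0) by exact: is_derive_add.
apply: (is_derive_eq (is_derive1_comp (f := f) _ h)).
by rewrite addr0 mulr1.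
Qed.

Definition slowly_varying (I : R -> R) := forall e, 0 < e -> exists a, forall x y,
  a <= x -> x <= y -> y <= x + 1 -> `|I y - I x| <= e.

(** With [J' = I], the mean [J (x + 1) - J x] of [I] over [[x, x + 1]] is continuously
    differentiable, and its derivative as well as its difference to [I]
    tend to 0: absorbing the mean of [I] into the derivative of [w] turns the
    system into a perturbation of [w'' = k^2 w] by vanishing coefficients. *)
Lemma quasi_derivative_decay_pinfty (k : R) (w U I S : R -> R) K : 0 < k ->
  continuous I -> slowly_varying I ->
  (forall x, is_derive x 1 w (U x + I x * w x)) ->
  (forall x, is_derive x 1 U (k ^+ 2 * w x - I x * (U x + I x * w x))) ->
  (forall x, is_derive x 1 S (w x ^+ 2)) -> (forall x y, x <= y -> S y - S x <= K) ->
  forall l, l < k -> exp_decay_pinfty l w /\ exp_decay_pinfty l (fun x => U x + I x * w x).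
Proof.
move=> k0 cI sI dw dU dS SK l lk.
pose J := primitive I; have dJ := is_derive_primitive cI.
pose A x := J (x + 1) - J x.
have dA x : is_derive x 1 A (I (x + 1) - I x).
  by apply: is_derive_sub => //; exact: is_derive_translate.
pose p x := I x - A x; pose u x := U x + A x * w x.
have wE : (fun x => U x + I x * w x) = (fun x => u x + p x * w x).
  by apply/funext => x; rewrite /u /p; ring.
have cw : continuous (fun x => U x + I x * w x).
  move=> x; apply: cvgD; first exact: (is_derive_continuous dU).
  by apply: cvgM; [exact: cI|exact: (is_derive_continuous dw)].
pose q x := I (x + 1) - I x - p x ^+ 2.
have dw' x : is_derive x 1 w (u x + p x * w x).
  by apply: (is_derive_eq (dw x)); rewrite /u /p; ring.
have du' x : is_derive x 1 u ((k ^+ 2 + q x) * w x - p x * u x).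
  apply: (is_derive_eq (is_derive_add (dU x) (is_derive_mul (dA x) (dw x)))).
  by rewrite /q /u /p; ring.
have cw' : continuous (fun x => u x + p x * w x) by rewrite -wE.
rewrite wE; apply: (hyperbolic_decay k0 dw' du' cw' dS SK) => // e e0.
pose e1 := Num.min 1 (e / 2).
have e10 : 0 < e1 by rewrite lt_min ltr01 divr_gt0.
have e11 : e1 <= 1 by rewrite ge_min lexx.
have e12 : e1 <= e / 2 by rewrite ge_min lexx orbT.
have [a aP] := sI e1 e10; exists a => x ax.
have x1 : x <= x + 1 by rewrite lerDl.
have px : `|p x| <= e1.
  have [z] := MVT_segment x1 (fun z _ => dJ z) (continuous_subspaceT (is_derive_continuous dJ)).
  rewrite in_itv/= => /andP[xz zx].
  rewrite (_ : x + 1 - x = 1) ?mulr1 => [Az|]; last by ring.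
  by rewrite /p /A Az distrC aP.
have sx := aP x (x + 1) ax x1 (lexx _).
split; first lra.
rewrite (le_trans (ler_normB _ _))// normrX.
have : `|p x| ^+ 2 <= e1 by rewrite expr2 -[leRHS]mulr1 ler_pM// (le_trans px).
lra.
Qed.

(** The system is invariant under [x -> - x] if [U] and [I] change sign. *)
Lemma quasi_derivative_decay (k : R) (w U I S : R -> R) K : 0 < k ->
  continuous I -> slowly_varying I -> slowly_varying (fun x => I (- x)) ->
  (forall x, is_derive x 1 w (U x + I x * w x)) ->
  (forall x, is_derive x 1 U (k ^+ 2 * w x - I x * (U x + I x * w x))) ->
  (forall x, is_derive x 1 S (w x ^+ 2)) -> (forall x y, x <= y -> S y - S x <= K) ->
  forall l, l < k -> exp_decay l w /\ exp_decay l (fun x => U x + I x * w x).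
Proof.
move=> k0 cI sI sI' dw dU dS SK l lk.
have [[C1 wC1] [C2 wC2]] := quasi_derivative_decay_pinfty k0 cI sI dw dU dS SK lk.
have [|||x|x|x|x y xy||[C3 wC3] [C4 wC4]] := @quasi_derivative_decay_pinfty k
  (fun x => w (- x)) (fun x => - U (- x)) (fun x => - I (- x))
  (fun x => - S (- x)) K _ _ _ _ _ _ _ l.
- exact: k0.
- move=> x; apply: cvgN; apply: (continuous_comp (f := -%R) (g := I)); last exact: cI.
  by apply: cvgN; exact: cvg_id.
- move=> e e0; have [a aP] := sI' e e0; exists a => x y ax xy yx.
  by rewrite -opprD normrN; apply: aP.
- by apply: (is_derive_eq (is_derive_reflect (dw (- x)))); ring.
- apply: (is_derive_eq (is_deriveN (is_derive_reflect (dU (- x))))); ring.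
- by apply: (is_derive_eq (is_deriveN (is_derive_reflect (dS (- x))))); rewrite opprK.
- have := @SK (- y) (- x); rewrite lerN2 => /(_ xy); lra.
- exact: lk.
have both (f : R -> R) C D : (forall x, 0 <= x -> `|f x| <= C * expR (- (l * x))) ->
    (forall x, 0 <= x -> `|f (- x)| <= D * expR (- (l * x))) -> exp_decay l f.
  move=> fC fD; exists (Num.max C D) => x; have [x0|/ltW x0] := leP 0 x.
    rewrite (ger0_norm x0) (le_trans (fC x x0))// ler_wpM2r ?expR_ge0//.
    by rewrite le_max lexx.
  rewrite (ler0_norm x0) -{1}[x]opprK (le_trans (fD (- x) _)) ?oppr_ge0//.
  by rewrite ler_wpM2r ?expR_ge0// le_max lexx orbT.
split; first exact: both wC1 wC3.
apply: (both _ C2 C4) => // x x0; have := wC4 x x0.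
by rewrite mulNr -opprD normrN.
Qed.

Lemma square_primitive_bounded w : continuous w -> w \in Lfun mu 2%:E ->
  exists K, forall x y, x <= y -> primitive (fun z => w z ^+ 2) y -
    primitive (fun z => w z ^+ 2) x <= K.
Proof.
move=> cw /Lfun2_integrable_sqr iw.
exists (\int[mu]_x (w x ^+ 2)) => x y xy.
rewrite primitiveB//; last first.
  apply: continuous_locally_integrable => z.
  exact: (continuous_comp (cw z) (@exprn_continuous _ 2 _)).
rewrite /Rintegral fine_le//.
- by apply: integrable_fin_num => //; apply: (integrableS measurableT) iw.
- exact: integrable_fin_num.
apply: ge0_subset_integral => //=; last by move=> z _; rewrite lee_fin sqr_ge0.
by case/integrableP : iw.
Qed.

Lemma slowly_varying_primitive (V : R -> R) : locally_integrable setT V ->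
  (fun x : R => \int[mu]_(s in `[x, (x + 1)%R]) `|V s|%:E)%E @ +oo --> 0%:E ->
  slowly_varying (primitive V).
Proof.
move=> lV Vy e e0.
have [a [_ aP]] : \forall x \near +oo, (\int[mu]_(s in `[x, (x + 1)%R]) `|V s|%:E <= e%:E)%E.
  apply: (Vy [set z | (z <= e%:E)%E]); change (\forall r \near (0 : R), (r%:E <= e%:E)%E).
  by apply: filterS (lt_nbhsl e0) => r /ltW.
exists (a + 1) => x y ax xy yx; rewrite -lee_fin (le_trans (le_primitiveB lV xy))//.
apply: le_trans (aP x _); last lra.
apply: ge0_subset_integral => //.
  by apply/measurable_EFinP/measurableT_comp => //; apply: measurable_funTS; case: lV.
by apply: subset_itv; rewrite bnd_simp.
Qed.

End Regularization.

(** * Exponentially decaying functions *)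

Section ExponentialDecay.
Context {R : realType}.
Implicit Types (a b x y : R) (f F : R -> R) (s t : seq (R * R)).

Local Notation mu := (@lebesgue_measure R).

(** The rates of exponential decay add up under products; growth is decay at a negative
    rate. *)
Lemma exp_decayM (k l : R) f F : exp_decay k f -> exp_decay l F ->
  exp_decay (k + l) (fun x => f x * F x).
Proof.
move=> [C Cf] [D DF]; exists (C * D) => x.
rewrite normrM mulrDl opprD expRD mulrACA ler_pM//.
Qed.

Lemma exp_decayD (k : R) f F : exp_decay k f -> exp_decay k F ->
  exp_decay k (fun x => f x + F x).
Proof.
move=> [C Cf] [D DF]; exists (C + D) => x.
by rewrite mulrDl (le_trans (ler_normD _ _))// lerD.
Qed.

Lemma exp_decay_cst (c : R) : exp_decay 0 (fun=> c).
Proof. by exists `|c| => x; rewrite mul0r oppr0 expR0 mulr1. Qed.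

Lemma exp_decayZ (k c : R) f : exp_decay k f -> exp_decay k (fun x => c * f x).
Proof. by move=> fk; rewrite -[k]add0r; apply: exp_decayM => //; exact: exp_decay_cst. Qed.

Lemma exp_decay_expR (k : R) : exp_decay (- `|k|) (fun x => expR (k * x)).
Proof.
exists 1 => x; rewrite mul1r ger0_norm ?expR_ge0// ler_expR mulNr opprK -normrM.
exact: ler_norm.
Qed.

Lemma exp_decay_id (e : R) : 0 < e -> exp_decay (- e) (fun x => x).
Proof.
move=> e0; exists e^-1 => x; rewrite mulNr opprK ler_pdivlMl//.
by rewrite (le_trans _ (expR_ge1Dx _))// lerDr.
Qed.

Lemma integrable_oneDsqrV : mu.-integrable setT (EFin \o (fun x : R => (oneDsqr x)^-1)).
Proof.
have cV := @continuous_oneDsqrV R.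
apply/integrableP; split.
  by apply/measurable_EFinP; exact: continuous_measurable_fun.
under eq_integral do rewrite /= ger0_norm ?invr_ge0 ?(le_trans ler01 (oneDsqr_ge1 _))//.
rewrite (ge0_symfun_integralT (f := fun x : R => (oneDsqr x)^-1))//.
- by rewrite -set_itvcy integral0y_oneDsqr -EFinM ltry.
- by move=> x; rewrite /= /oneDsqr sqrrN.
Qed.

(** [1 + x^2] is at most a multiple of [(1 + h |x|)^2], hence of [exp (2 h |x|)]. *)
Lemma integrable_exp_decay (k : R) f : 0 < k -> continuous f -> exp_decay k f ->
  mu.-integrable setT (EFin \o f).
Proof.
move=> k0 cf [C Cf].
pose h := k / 2; have h0 : 0 < h by rewrite divr_gt0.
pose D := C * (1 + h ^- 2).
have iD : mu.-integrable setT (EFin \o (fun x : R => D * (oneDsqr x)^-1)).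
  have := integrableZl measurableT D integrable_oneDsqrV.
  by apply: eq_integrable => // x _; rewrite /= EFinM.
apply: (le_integrable measurableT _ _ iD).
  by apply/measurable_EFinP; exact: continuous_measurable_fun.
move=> x _; rewrite /= lee_fin (le_trans _ (ler_norm _))// (le_trans (Cf x))//.
have C0 : 0 <= C.
  by have := Cf 0; rewrite normr0 mulr0 oppr0 expR0 mulr1; exact: le_trans.
rewrite /D -mulrA ler_wpM2l// expRN ler_pdivlMr; last first.
  exact: (lt_le_trans ltr01 (oneDsqr_ge1 _)).
rewrite mulrC ler_pdivrMr ?expR_gt0//.
have hx : 1 + h * `|x| <= expR (h * `|x|) by exact: expR_ge1Dx.
have -> : k * `|x| = 2%:R * (h * `|x|) by rewrite /h; field.
have hx0 : 0 <= h * `|x| by rewrite mulr_ge0// ltW.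
rewrite expRM_natl; apply: (@le_trans _ _ ((1 + h ^- 2) * (1 + h * `|x|) ^+ 2)); last first.
  by rewrite ler_wpM2l ?lerXn2r ?nnegrE ?expR_ge0 ?addr_ge0 ?invr_ge0 ?sqr_ge0.
have -> : oneDsqr x = 1 + h ^- 2 * (h * `|x|) ^+ 2.
  by rewrite /oneDsqr -(@real_normK _ x) ?num_real//; field; rewrite gt_eqF.
have : 0 <= h ^- 2 by rewrite invr_ge0 sqr_ge0.
move: (h ^- 2) (h * `|x|) hx0 => u v u0 v0 {hx}; nra.
Qed.

Lemma Lfun2_of_integrable f : measurable_fun setT f ->
  mu.-integrable setT (EFin \o (fun x => f x ^+ 2)) -> f \in Lfun mu 2%:E.
Proof.
move=> mf /integrableP[_ if2]; rewrite inE; apply/andP; split; rewrite inE//=.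
rewrite /finite_norm unlock poweR_lty//.
apply: le_lt_trans if2; rewrite le_eqVlt; apply/orP; left; apply/eqP.
apply: eq_integral => x _ /=.
by rewrite normrX powR_mulrn.
Qed.

Lemma Lfun2_measurable f : f \in Lfun mu 2%:E -> measurable_fun setT f.
Proof. by rewrite inE => /andP[/[!inE]]. Qed.

Lemma Lfun2_exp_decay (k : R) f : 0 < k -> continuous f -> exp_decay k f ->
  f \in Lfun mu 2%:E.
Proof.
move=> k0 cf fk; apply: Lfun2_of_integrable; first exact: continuous_measurable_fun.
apply: (@integrable_exp_decay (k + k)); first exact: addr_gt0.
  by move=> x; apply: (continuous_comp (cf x) (@exprn_continuous _ 2 _)).
exact: exp_decayM.
Qed.

Lemma Lfun2_linear (c : R) f F : f \in Lfun mu 2%:E -> F \in Lfun mu 2%:E ->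
  (fun x => f x + c * F x) \in Lfun mu 2%:E.
Proof.
move=> lf lF; have mf := Lfun2_measurable lf; have mF := Lfun2_measurable lF.
have mG : measurable_fun setT (fun x => f x + c * F x).
  by apply: measurable_funD => //; exact: measurable_funM.
apply: Lfun2_of_integrable => //.
have i1 := integrableZl measurableT 2 (Lfun2_integrable_sqr lf).
have i2 := integrableZl measurableT (2 * c ^+ 2) (Lfun2_integrable_sqr lF).
apply: (le_integrable measurableT _ _ (integrableD measurableT i1 i2)).
  by apply/measurable_EFinP; exact: measurable_funX.
move=> x _.
change (`|(f x + c * F x) ^+ 2| <= `|2 * f x ^+ 2 + 2 * c ^+ 2 * F x ^+ 2|).
apply: le_trans (ler_norm _).
rewrite ger0_norm ?sqr_ge0//; have := sqr_ge0 (f x - c * F x); nra.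
Qed.

(** The integral of [dG] over [[- n, n]] is [G n - G (- n)], which tends to 0. *)
Lemma Rintegral_exact_ge0 (k : R) (F G dG : R -> R) : 0 < k ->
  continuous F -> exp_decay k F ->
  continuous dG -> (forall x, is_derive x 1 G (dG x)) -> exp_decay k G ->
  (forall x, dG x <= F x) -> 0 <= \int[mu]_x F x.
Proof.
move=> k0 cF Fk cdG dGP Gk dGF.
have iF := integrable_exp_decay k0 cF Fk.
have [C CG] := Gk.
pose I n : set R := `[- n%:R, n%:R]%classic.
have mI n : measurable (I n) by exact: measurable_itv.
pose h n x := ((F \_ (I n)) x)%:E.
have ifn n : measurable_fun setT (h n).
  apply/measurable_EFinP/(measurable_restrictT _ _).1 => //.
  by apply: measurable_funTS; exact: continuous_measurable_fun.
have hF : {ae mu, forall x, setT x -> h ^~ x @ \oo --> (EFin \o F) x}.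
  apply: aeW => x _; apply: cvg_near_cst.
  near=> n; rewrite /h patchE mem_set// /I/= in_itv/= -ler_norml.
  by near: n; exact: nbhs_infty_ger.
have hdom : {ae mu, forall x n, setT x -> (`|h n x| <= (abse \o (EFin \o F)) x)%E}.
  apply: aeW => x n _; rewrite /h lee_fin patchE.
  by case: ifP => // _; rewrite normr0.
have [_ _ cvI] := @dominated_convergence _ _ _ mu setT measurableT h (EFin \o F)
  (abse \o (EFin \o F)) ifn (measurable_int _ iF) hF (integrable_abse iF) hdom.
have hn n : ((- (2 * C * expR (- (k * n%:R))))%:E <= \int[mu]_x h n x)%E.
  have -> : (\int[mu]_x h n x = \int[mu]_(x in I n) (F x)%:E)%E.
    by rewrite [RHS]integral_mkcond; apply: eq_integral => x _; rewrite restrict_EFin.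
  have C0 : 0 <= C.
    by have := CG 0; rewrite normr0 mulr0 oppr0 expR0 mulr1; exact: le_trans.
  case: n => [|n].
    rewrite /I oppr0 set_itv1 integral_set1 lee_fin oppr_le0.
    by rewrite !mulr_ge0// expR_ge0.
  have n0 : - n.+1%:R < n.+1%:R :> R by rewrite gt0_cp.
  have cG := is_derive_continuous dGP.
  have GE : (\int[mu]_(x in I n.+1) (dG x)%:E = (G n.+1%:R)%:E - (G (- n.+1%:R))%:E)%E.
    apply: continuous_FTC2 => //; first exact: continuous_subspaceT.
      split; first by move=> x _; have [] := dGP x.
        by apply: cvg_at_right_filter; exact: cG.
      by apply: cvg_at_left_filter; exact: cG.
    by move=> x _; rewrite derive1E; exact: derive_val.
  have iI f : continuous f -> mu.-integrable (I n.+1) (EFin \o f).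
    move=> cf; apply: continuous_compact_integrable; first exact: segment_compact.
    exact: continuous_subspaceT.
  apply: (@le_trans _ _ (\int[mu]_(x in I n.+1) (dG x)%:E)%E).
    rewrite GE -EFinB lee_fin.
    have := CG n.+1%:R; have := CG (- n.+1%:R).
    rewrite normrN (ger0_norm (ler0n R n.+1)) !ler_norml => /andP[_ ?] /andP[? _]; lra.
  apply: le_integral; [exact: mI|exact: (iI _ cdG)|exact: (iI _ cF)|].
  by move=> x _; rewrite lee_fin.
have cvL : (fun n : nat => (- (2 * C * expR (- (k * n%:R))))%:E) @ \oo --> (- (2 * C * 0))%:E.
  apply: cvg_EFin; first exact: nearW.
  apply: cvgN; apply: cvgMl_tmp.
  under eq_cvg do rewrite -mulNr expRM_natr.
  by apply: cvg_expr; rewrite ger0_norm ?expR_ge0// expR_lt1 oppr_lt0.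
apply: fine_ge0.
suff : (limn (fun n : nat => (- (2 * C * expR (- (k * n%:R))))%:E) <=
    limn (fun n => \int[mu]_x h n x))%E.
  by rewrite (cvg_lim _ cvL)// (cvg_lim _ cvI)// mulr0 oppr0.
apply: lee_lim; last exact: nearW.
- by apply/cvg_ex; eexists; exact: cvL.
- by apply/cvg_ex; eexists; exact: cvI.
Unshelve. all: by end_near. Qed.

End ExponentialDecay.

(** * The operator on real valued functions *)

Section RealGraph.
Context {R : realType}.
Implicit Types (a b x y : R) (f F : R -> R) (s t : seq (R * R)).

Local Notation mu := (@lebesgue_measure R).

Lemma is_derive_of_derivable f x : derivable f x 1 -> is_derive x 1 f (derive1 f x).
Proof. by move=> df; apply: DeriveDef => //; rewrite derive1E. Qed.

Lemma derive1_eq f df x : is_derive x 1 f df -> derive1 f x = df.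
Proof. by move=> fdf; rewrite derive1E derive_val. Qed.

Lemma exp_decay_constant0 (k c : R) : 0 < k -> exp_decay k (fun=> c) -> c = 0.
Proof.
move=> k0 [C cC]; apply/eqP; rewrite -normr_le0; apply/ler_addgt0Pl => e e0; rewrite addr0.
have C1 : 0 < `|C| + 1 by rewrite ltr_wpDl.
pose x := (`|C| + 1) / (k * e).
have x0 : 0 <= x by rewrite ltW// divr_gt0// mulr_gt0.
rewrite (le_trans (cC x))// expRN ler_pdivrMr ?expR_gt0// (ger0_norm x0).
have -> : k * x = (`|C| + 1) / e by rewrite /x; field; rewrite !gt_eqF.
rewrite -ler_pdivrMl// (le_trans _ (expR_ge1Dx _))// [leRHS]addrC.
have : C / e <= (`|C| + 1) / e.
  by rewrite ler_pM2r ?invr_gt0// (le_trans (ler_norm _))// lerDl.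
by rewrite mulrC; lra.
Qed.

Lemma locally_zero_derive f : (forall x, is_derive x 1 f 0) -> forall x y, f x = f y.
Proof. by move=> f0 x y; exact: is_derive_0_is_cst. Qed.

Section RealOperator.
Variables (b c : R) (V : R -> R).
Hypotheses (b_gt0 : 0 < b) (c_gt0 : 0 < c) (V_loc : locally_integrable setT V).
Hypothesis V_pinfty : (fun x : R => \int[mu]_(s in `[x, (x + 1)%R]) `|V s|%:E)%E @ +oo --> 0%:E.
Hypothesis V_ninfty : (fun x : R => \int[mu]_(s in `[x, (x + 1)%R]) `|V s|%:E)%E @ -oo --> 0%:E.
Implicit Types (w g : R -> R).

(** The real counterpart of [graphH]; the local absolute continuity of [w] itself
    follows from that of its derivative. *)
Definition real_graph w g := [/\ w \in Lfun mu 2%:E,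
  (forall x, derivable w x 1), AC_loc (derive1 w), g \in Lfun mu 2%:E &
  {ae mu, forall x, - c ^+ 2 * derive1 (derive1 w) x + b ^+ 2 * w x + V x * w x = g x}].

Lemma real_graph_linear (a : R) w1 w2 g1 g2 : real_graph w1 g1 -> real_graph w2 g2 ->
  real_graph (fun x => w1 x + a * w2 x) (fun x => g1 x + a * g2 x).
Proof.
move=> [l1 d1 ac1 lg1 e1] [l2 d2 ac2 lg2 e2].
have dw x : is_derive x 1 (fun x => w1 x + a * w2 x) (derive1 w1 x + a * derive1 w2 x).
  apply: is_derive_add; first exact: is_derive_of_derivable.
  by apply: is_derive_scale; exact: is_derive_of_derivable.
have dwE : derive1 (fun x => w1 x + a * w2 x) = fun x => derive1 w1 x + a * derive1 w2 x.
  by apply/funext => x; exact: derive1_eq.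
split; [exact: Lfun2_linear|by move=> x; have [] := dw x| | exact: Lfun2_linear|].
  by rewrite dwE; apply: AC_locD => //; exact: AC_locZ.
rewrite dwE.
apply: ae_imply2 (AC_loc_ae_derivable ac1) _.
  2: exact: (ae_and (AC_loc_ae_derivable ac2) (ae_and e1 e2)).
move=> x dd1 [dd2 [<- <-]] /=.
rewrite (derive1_eq (is_derive_add (is_derive_of_derivable dd1)
  (is_derive_scale a (is_derive_of_derivable dd2)))).
move: (derive1 (derive1 w1) x) (derive1 (derive1 w2) x) => A B; ring.
Qed.

(** The product rule for the second derivative: the commutator of the operator with the
    multiplication by [e] is [- c^2 (e'' + 2 e' d/dx)]. *)
Lemma real_graph_mul (e e1 e2 : R -> R) w g G :
  (forall x, is_derive x 1 e (e1 x)) -> (forall x, is_derive x 1 e1 (e2 x)) ->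
  continuous e2 -> real_graph w g ->
  (fun x => e x * w x) \in Lfun mu 2%:E -> G \in Lfun mu 2%:E ->
  (forall x, G x = e x * g x - c ^+ 2 * (e2 x * w x + 2 * e1 x * derive1 w x)) ->
  real_graph (fun x => e x * w x) G.
Proof.
move=> de de1 ce2 [lw dw acw lg we] ly lG GE.
have dw' x := is_derive_of_derivable (dw x).
have ace1 := AC_loc_C1 de1 ce2.
have ace := AC_loc_C1 de (AC_loc_continuous ace1).
have acw0 := AC_loc_C1 dw' (AC_loc_continuous acw).
have dy x : is_derive x 1 (fun x => e x * w x) (e1 x * w x + e x * derive1 w x).
  exact: is_derive_mul.
have dyE : derive1 (fun x => e x * w x) = fun x => e1 x * w x + e x * derive1 w x.
  by apply/funext => x; exact: derive1_eq.
split; [by []|by move=> x; have [] := dy x| |by []|].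
  by rewrite dyE; apply: AC_locD; exact: AC_locM.
rewrite dyE; apply: ae_imply2 (AC_loc_ae_derivable acw) we => x ddw wx.
rewrite (derive1_eq (is_derive_add (is_derive_mul (de1 x) (dw' x))
   (is_derive_mul (de x) (is_derive_of_derivable ddw)))) GE -wx.
move: (derive1 (derive1 w) x) (derive1 w x) => A B; ring.
Qed.

Let slow_pinfty : slowly_varying (primitive V).
Proof. exact: slowly_varying_primitive. Qed.

Let slow_ninfty : slowly_varying (fun x => primitive V (- x)).
Proof.
move=> e e0.
have small : nbhs (0%:E : \bar R) [set z : \bar R | (z <= e%:E)%E].
  change (\forall r \near (0 : R), (r%:E <= e%:E)%E).
  by apply: filterS (lt_nbhsl e0) => r /ltW.
have [a [_ aP]] := V_ninfty small.
exists (1 - a) => x y ax xy yx; rewrite distrC.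
have yx' : - y <= - x by rewrite lerN2.
rewrite -lee_fin (le_trans (le_primitiveB V_loc yx'))//.
apply: le_trans (aP (- y) _); last lra.
apply: ge0_subset_integral => //.
  by apply/measurable_EFinP/measurableT_comp => //; apply: measurable_funTS; case: V_loc.
by apply: subset_itv; rewrite bnd_simp//; lra.
Qed.

Let slowly_varyingZ (a : R) (I : R -> R) : 0 < a -> slowly_varying I ->
  slowly_varying (fun x => a * I x).
Proof.
move=> a0 sI e e0; have [d dP] := sI _ (divr_gt0 e0 a0); exists d => x y dx xy yx.
by rewrite -mulrBr normrM gtr0_norm// mulrC -ler_pdivlMr// dP.
Qed.

(** With [k = sqrt (b^2 - lam) / c] and a primitive [I] of [V / c^2], the
    quasi-derivative [w' - I w] has the continuous derivative [k^2 w - I w'], so that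
    the decay estimate for regularized systems applies. *)
Lemma eigenfunction_decay (lam l : R) w : 0 <= l -> (c * l) ^+ 2 < b ^+ 2 - lam ->
  real_graph w (fun x => lam * w x) -> exp_decay l w /\ exp_decay l (derive1 w).
Proof.
move=> l0 lk [lw dw acw _ we].
have dw' x := is_derive_of_derivable (dw x).
have c2 : 0 < c ^- 2 by rewrite invr_gt0 exprn_gt0.
(* [U] is the quasi-derivative of [w]: the singular term [V w] of [w''] cancels in its
   derivative. *)
pose I x := c ^- 2 * primitive V x.
have acI : AC_loc I by apply: AC_locZ; exact: AC_loc_primitive.
have cI := AC_loc_continuous acI.
have bl : 0 < b ^+ 2 - lam by rewrite (le_lt_trans _ lk)// sqr_ge0.
pose k := Num.sqrt ((b ^+ 2 - lam) / c ^+ 2).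
have k0 : 0 < k by rewrite sqrtr_gt0 divr_gt0// exprn_gt0.
have k2 : k ^+ 2 = (b ^+ 2 - lam) / c ^+ 2 by rewrite sqr_sqrtr// ltW// divr_gt0// exprn_gt0.
have llk : l < k.
  by rewrite -ltr_sqr ?nnegrE// ?ltW// k2 ltr_pdivlMr ?exprn_gt0// -exprMn mulrC.
pose U x := derive1 w x - I x * w x.
have wE x : derive1 w x = U x + I x * w x by rewrite /U subrK.
have cw := is_derive_continuous dw'.
have cdw := AC_loc_continuous acw.
have acU : AC_loc U.
  by apply: AC_locB => //; apply: AC_locM => //; exact: (AC_loc_C1 dw').
have dU x : is_derive x 1 U (k ^+ 2 * w x - I x * derive1 w x).
  apply: (AC_loc_is_derive (h := fun x => k ^+ 2 * w x - I x * derive1 w x)) => //.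
    move=> y; apply: cvgB; apply: cvgM; [exact: cvg_cst|exact: cw|exact: cI|exact: cdw].
  apply: ae_imply2 (AC_loc_ae_derivable acw) _.
    2: exact: (ae_and (ae_derive_primitive V_loc) we).
  move=> y ddw [dV wy].
  rewrite (derive1_eq (is_derive_sub (is_derive_of_derivable ddw)
     (is_derive_mul (is_derive_scale (c ^- 2) dV) (dw' y)))) k2.
  have -> : derive1 (derive1 w) y = c ^- 2 * (b ^+ 2 * w y + V y * w y - lam * w y).
    by rewrite -wy; field; rewrite gt_eqF.
  by rewrite /I; field; rewrite gt_eqF.
have [K SK] := square_primitive_bounded cw lw.
have dS x : is_derive x 1 (primitive (fun z => w z ^+ 2)) (w x ^+ 2).
  apply: (is_derive_primitive (f := fun z => w z ^+ 2)) => z.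
  exact: (continuous_comp (cw z) (@exprn_continuous _ 2 _)).
have := quasi_derivative_decay k0 cI (slowly_varyingZ c2 slow_pinfty)
  (slowly_varyingZ c2 slow_ninfty) (w := w) (U := U).
move=> /(_ _ K _ _ dS SK l llk) [].
- by move=> x; rewrite -wE.
- by move=> x; rewrite -wE.
- by under eq_fun do rewrite -wE.
Qed.

(** Multiplication by [expR (- m x)] is the imaginary gauge transformation
    [y = expR (i z x / (2 c^2)) w] at [z = 2 i c^2 m]; it turns the eigenvalue
    equation at [- c^2 m^2] into the pencil equation at [z]. The new function is
    still square integrable, as [w] decays at a rate larger than [m]. *)
Lemma real_graph_gauge (m : R) w : 0 < m ->
  real_graph w (fun x => - (c * m) ^+ 2 * w x) ->
  let y x := expR (- m * x) * w x in
  real_graph y (fun x => 2 * c ^+ 2 * m * derive1 y x).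
Proof.
move=> m0 gw y; have [lw dw acw _ we] := gw.
have dw' x := is_derive_of_derivable (dw x).
have cw := is_derive_continuous dw'; have cdw := AC_loc_continuous acw.
have dE x : is_derive x 1 (fun x => expR (- m * x)) (- m * expR (- m * x)).
  exact: is_derive_expRM.
have cE := is_derive_continuous dE.
have dy x : is_derive x 1 y (- m * expR (- m * x) * w x + expR (- m * x) * derive1 w x).
  exact: is_derive_mul.
(* A rate between [m] and the bound [sqrt (b^2 + (c m)^2) / c] on the decay of [w]. *)
pose l := Num.sqrt ((c * m) ^+ 2 + b ^+ 2 / 2) / c.
have l2 : (c * l) ^+ 2 = (c * m) ^+ 2 + b ^+ 2 / 2.
  rewrite /l mulrCA divff ?gt_eqF// mulr1 sqr_sqrtr// addr_ge0 ?sqr_ge0//.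
  by rewrite divr_ge0 ?sqr_ge0.
have b2 : 0 < b ^+ 2 by rewrite exprn_gt0.
have l0 : 0 <= l by rewrite divr_ge0 ?sqrtr_ge0// ltW.
have ml : m < l.
  have cm0 : 0 <= c * m by rewrite ltW// mulr_gt0.
  have cl0 : 0 <= c * l by rewrite mulr_ge0// ltW.
  by rewrite -(ltr_pM2l c_gt0) -ltr_sqr ?nnegrE// l2; lra.
have [wl dwl] : exp_decay l w /\ exp_decay l (derive1 w).
  by apply: (eigenfunction_decay l0 _ gw); rewrite l2; lra.
have lm : 0 < - `|- m| + l by rewrite normrN gtr0_norm//; lra.
have El := exp_decay_expR (- m).
have yl : exp_decay (- `|- m| + l) y by exact: exp_decayM.
have dyl : exp_decay (- `|- m| + l)
    (fun x => - m * expR (- m * x) * w x + expR (- m * x) * derive1 w x).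
  apply: exp_decayD; apply: exp_decayM => //; exact: exp_decayZ.
have cy : continuous y by exact: is_derive_continuous dy.
have cdy : continuous (fun x => - m * expR (- m * x) * w x + expR (- m * x) * derive1 w x).
  move=> x; apply: cvgD; apply: cvgM; [|exact: cw|exact: cE|exact: cdw].
  by apply: cvgM; [exact: cvg_cst|exact: cE].
have dyE : derive1 y = fun x => - m * expR (- m * x) * w x + expR (- m * x) * derive1 w x.
  by apply/funext => x; exact: derive1_eq.
apply: (real_graph_mul dE (e2 := fun x => - m * (- m * expR (- m * x))) _ _ gw).
- move=> x; apply: cvgM; [exact: cvg_cst|].
  by apply: cvgM; [exact: cvg_cst|exact: cE].
- exact: (Lfun2_exp_decay lm cy yl).
- rewrite dyE; apply: (Lfun2_exp_decay lm).
    by move=> x; apply: cvgM; [exact: cvg_cst|exact: cdy].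
  exact: exp_decayZ.
- by move=> x; rewrite dyE; ring.
Qed.

(** At the eigenvalue 0, half of the bound [b / c] on the rates is a convenient choice. *)
Lemma kernel_decay w : real_graph w (fun=> 0) ->
  exp_decay (b / c / 2) w /\ exp_decay (b / c / 2) (derive1 w).
Proof.
move=> gw; apply: (@eigenfunction_decay 0).
- by rewrite !divr_ge0// ltW.
- rewrite subr0 (_ : c * _ = b / 2); last by field; rewrite gt_eqF.
  by have := b_gt0; nra.
- by under eq_fun do rewrite mul0r.
Qed.

Let r := b / c / 2.
Let r_gt0 : 0 < r. Proof. by rewrite !divr_gt0. Qed.

(** The commutator of the operator with the multiplication by [x] is
    [- 2 c^2 d/dx]. *)
Lemma real_graph_position w : real_graph w (fun=> 0) ->
  real_graph (fun x => x * w x) (fun x => - (2 * c ^+ 2) * derive1 w x).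
Proof.
move=> gw; have [wl dwl] := kernel_decay gw; have [lw dw acw _ we] := gw.
have dw' x := is_derive_of_derivable (dw x).
have cw := is_derive_continuous dw'; have cdw := AC_loc_continuous acw.
apply: (real_graph_mul (fun x => is_derive_id x 1) (e2 := fun=> 0) _ _ gw) => [x|||x].
- exact: cvg_cst.
- apply: (@Lfun2_exp_decay _ (- (r / 2) + r)).
  + by have := r_gt0; lra.
  + by move=> x; apply: cvgM; [exact: cvg_id|exact: cw].
  + by apply: exp_decayM => //; apply: exp_decay_id; rewrite divr_gt0.
- apply: (Lfun2_exp_decay r_gt0); last exact: exp_decayZ.
  by move=> x; apply: cvgM; [exact: cvg_cst|exact: cdw].
- by ring.
Qed.

(** The Wronskian of two elements of the kernel is constant, and it vanishes at
    infinity. *)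
Lemma kernel_wronskian p q : real_graph p (fun=> 0) -> real_graph q (fun=> 0) ->
  forall x, p x * derive1 q x = q x * derive1 p x.
Proof.
move=> gp gq; have [pl dpl] := kernel_decay gp; have [ql dql] := kernel_decay gq.
have [_ dp acp _ pe] := gp; have [_ dq acq _ qe] := gq.
have dp' x := is_derive_of_derivable (dp x); have dq' x := is_derive_of_derivable (dq x).
have ap := AC_loc_C1 dp' (AC_loc_continuous acp).
have aq := AC_loc_C1 dq' (AC_loc_continuous acq).
pose W x := p x * derive1 q x - q x * derive1 p x.
have acW : AC_loc W by apply: AC_locB; exact: AC_locM.
have dW x : is_derive x 1 W 0.
  apply: (AC_loc_is_derive (h := fun=> 0) acW); first by move=> y; exact: cvg_cst.
  apply: ae_imply2 (ae_and (AC_loc_ae_derivable acp) (AC_loc_ae_derivable acq))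
    (ae_and pe qe) => y [ddp ddq] [py qy].
  rewrite (derive1_eq (is_derive_sub (is_derive_mul (dp' y) (is_derive_of_derivable ddq))
     (is_derive_mul (dq' y) (is_derive_of_derivable ddp)))).
  apply: (@mulfI _ (c ^+ 2)); first by rewrite expf_neq0// gt_eqF.
  move: (derive1 (derive1 p) y) (derive1 (derive1 q) y) py qy => A B py qy.
  have e1 : c ^+ 2 * A = b ^+ 2 * p y + V y * p y by lra.
  have e2 : c ^+ 2 * B = b ^+ 2 * q y + V y * q y by lra.
  rewrite mulr0; move: (derive1 p y) (derive1 q y) => A1 B1.
  transitivity (p y * (c ^+ 2 * B) - q y * (c ^+ 2 * A)); first by ring.
  by rewrite e1 e2; ring.
have Wl : exp_decay (r + r) W.
  have [C1 h1] := exp_decayM pl dql; have [C2 h2] := exp_decayM ql dpl.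
  by exists (C1 + C2) => x; rewrite mulrDl (le_trans (ler_normB _ _))// lerD.
move=> x; apply/eqP; rewrite -subr_eq0; apply/eqP; apply: (@exp_decay_constant0 (r + r)).
  by rewrite addr_gt0.
rewrite -[_ - _]/(W x) (_ : (fun=> W x) = W)//.
by apply/funext => y; exact: locally_zero_derive.
Qed.

(** With [phi = a psi0 - x psi0 / (2 c^2)], the real part of [phi * conj psi0'] is a
    derivative plus [|psi0|^2 / (4 c^2)]. *)
Lemma kernel_form_ge0 p q (al be : R) :
  real_graph p (fun=> 0) -> real_graph q (fun=> 0) ->
  0 <= \int[mu]_x
    ((al * p x - be * q x - (2 * c ^+ 2)^-1 * (x * p x)) * derive1 p x +
     (al * q x + be * p x - (2 * c ^+ 2)^-1 * (x * q x)) * derive1 q x).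
Proof.
move=> gp gq; have [pl dpl] := kernel_decay gp; have [ql dql] := kernel_decay gq.
have wr := kernel_wronskian gp gq.
have [_ dp acp _ _] := gp; have [_ dq acq _ _] := gq.
have dp' x := is_derive_of_derivable (dp x); have dq' x := is_derive_of_derivable (dq x).
have cp := is_derive_continuous dp'; have cq := is_derive_continuous dq'.
have cdp := AC_loc_continuous acp; have cdq := AC_loc_continuous acq.
pose d := (2 * c ^+ 2)^-1.
have d0 : 0 <= d by rewrite invr_ge0 mulr_ge0// sqr_ge0.
pose h x := p x * p x + q x * q x.
pose dh x := derive1 p x * p x + p x * derive1 p x + (derive1 q x * q x + q x * derive1 q x).
have dhP x : is_derive x 1 h (dh x) by apply: is_derive_add; exact: is_derive_mul.
have hl : exp_decay (r + r) h by apply: exp_decayD; exact: exp_decayM.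
have dhl : exp_decay (r + r) dh by apply: exp_decayD; apply: exp_decayD; exact: exp_decayM.
have ch := is_derive_continuous dhP.
have cM (f g : R -> R) : continuous f -> continuous g -> continuous (fun x => f x * g x).
  by move=> cf cg x; apply: cvgM; [exact: cf|exact: cg].
have cD (f g : R -> R) : continuous f -> continuous g -> continuous (fun x => f x + g x).
  by move=> cf cg x; apply: cvgD; [exact: cf|exact: cg].
have cC (a : R) : continuous (fun _ : R => a) by move=> x; exact: cvg_cst.
have cI : continuous (fun x : R => x) by move=> x; exact: cvg_id.
have cdh : continuous dh by apply: (cD); apply: (cD); apply: (cM).
pose G x := (al / 2) * h x + (- d / 2) * (x * h x).
pose dG x := (al / 2) * dh x + (- d / 2) * (1 * h x + x * dh x).
have dGP x : is_derive x 1 G (dG x).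
  apply: is_derive_add; apply: is_derive_scale => //.
  by apply: is_derive_mul.
pose F x := dG x + (d / 2) * h x.
have s0 : 0 < - r + (r + r) by have := r_gt0; lra.
have slow f : exp_decay (r + r) f -> exp_decay (- r + (r + r)) f.
  move=> [C Cf]; exists C => x; rewrite (le_trans (Cf x))// ler_wpM2l//.
    by have := Cf 0; rewrite normr0 mulr0 oppr0 expR0 mulr1; exact: le_trans.
  by rewrite ler_expR lerN2 ler_wpM2r//; have := r_gt0; lra.
have xl f : exp_decay (r + r) f -> exp_decay (- r + (r + r)) (fun x => x * f x).
  by apply: exp_decayM; exact: exp_decay_id r_gt0.
rewrite (_ : (fun x => _) = F); last first.
  apply/funext => x; rewrite /F /dG /dh /h -/d.
  have := wr x; set A := derive1 p x; set B := derive1 q x => pq.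
  have pq0 : be * (p x * B - q x * A) = 0 by rewrite pq subrr mulr0.
  by rewrite -[RHS]addr0 -pq0; field.
apply: (@Rintegral_exact_ge0 R (- r + (r + r)) F G dG) => //.
- apply: (cD); last exact: cM.
  apply: (cD); apply: (cM) => //; apply: (cD); exact: cM.
- apply: exp_decayD; last by apply: exp_decayZ; exact: slow.
  apply: exp_decayD; first by apply: exp_decayZ; exact: slow.
  apply: exp_decayZ; apply: exp_decayD; last exact: xl.
  by under eq_fun do rewrite mul1r; exact: slow.
- by apply: (cD); apply: (cM) => //; apply: (cD); exact: cM.
- by apply: exp_decayD; apply: exp_decayZ; [exact: slow|exact: xl].
- by move=> x; rewrite /F lerDl mulr_ge0 ?divr_ge0// addr_ge0// -expr2 sqr_ge0.
Qed.
End RealOperator.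

End RealGraph.

(** * The pencil on complex valued functions *)

Section Pencil.
Context {R : realType}.
Implicit Types (a b x y : R) (f F : R -> R) (s t : seq (R * R)).

Local Notation mu := (@lebesgue_measure R).
Local Notation Re := (@complex.Re R).
Local Notation Im := (@complex.Im R).
Local Notation derivC := (@Defs.derivC R).
Implicit Types (u v psi phi : R -> R[i]).
Local Open Scope complex_scope.

Lemma complex_ext (z1 z2 : R[i]) : Re z1 = Re z2 -> Im z1 = Im z2 -> z1 = z2.
Proof. by case: z1 z2 => [? ?] [? ?] /= -> ->. Qed.

Section ComplexOperator.
Variables (b c : R) (V : R -> R).

Lemma Re_tau u x : Re (tau b c V u x) =
  - c ^+ 2 * derive1 (derive1 (Re \o u)) x + b ^+ 2 * (Re \o u) x + V x * (Re \o u) x.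
Proof.
rewrite /tau (_ : derivC (derivC u) x =
  derive1 (derive1 (Re \o u)) x +i* derive1 (derive1 (Im \o u)) x)//.
move: (derive1 (derive1 (Re \o u)) x) (derive1 (derive1 (Im \o u)) x) => A B /=.
by case: (u x) => u1 u2 /=; ring.
Qed.

Lemma Im_tau u x : Im (tau b c V u x) =
  - c ^+ 2 * derive1 (derive1 (Im \o u)) x + b ^+ 2 * (Im \o u) x + V x * (Im \o u) x.
Proof.
rewrite /tau (_ : derivC (derivC u) x =
  derive1 (derive1 (Re \o u)) x +i* derive1 (derive1 (Im \o u)) x)//.
move: (derive1 (derive1 (Re \o u)) x) (derive1 (derive1 (Im \o u)) x) => A B /=.
by case: (u x) => u1 u2 /=; ring.
Qed.

(** The coefficients being real, the operator acts separately on real and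
    imaginary parts. *)
Lemma graphH_real u v : graphH b c V u v <->
  real_graph b c V (Re \o u) (Re \o v) /\ real_graph b c V (Im \o u) (Im \o v).
Proof.
split=> [[[[lu1 lu2] _ du [ac1 ac2] _] [lv1 lv2] tu]|].
  split; split => //.
  - by move=> x; have [] := du x.
  - by apply: ae_imply tu => x tux; rewrite -Re_tau tux.
  - by move=> x; have [] := du x.
  - by apply: ae_imply tu => x tux; rewrite -Im_tau tux.
move=> [[l1 d1 ac1 lv1 e1] [l2 d2 ac2 lv2 e2]].
have tu : {ae mu, forall x, tau b c V u x = v x}.
  by apply: ae_imply2 e1 e2 => x x1 x2; apply: complex_ext; rewrite ?Re_tau ?Im_tau.
have AC1 w : (forall x, derivable w x 1) -> AC_loc (derive1 w) -> AC_loc w.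
  move=> dw acw; apply: (AC_loc_C1 (df := derive1 w)).
    by move=> x; exact: is_derive_of_derivable.
  exact: AC_loc_continuous.
split=> //; split=> //; first by split; exact: AC1.
by exists v.
Qed.

Lemma real_graph0 w g : real_graph b c V w g -> real_graph b c V (fun=> 0) (fun=> 0).
Proof.
move=> gw; have := real_graph_linear (-1) gw gw.
have E f : (fun x => f x + -1 * f x) = fun=> 0.
  by apply/funext => x; rewrite mulN1r subrr.
by rewrite (E w) (E g).
Qed.

(** If no negative number is an eigenvalue, then the multiplicity of each of them is
    the supremum of [{0}]. *)
Lemma kappa_minus_ge1 : (1%:E <= kappa_minus b c V)%E ->
  exists lam : R, lam < 0 /\ exists2 psi, psi <> (fun=> 0) &
    graphH b c V psi (fun x => lam%:C * psi x).
Proof.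
apply: contraPP => noeig; apply/negP; rewrite -ltNge /kappa_minus esum1 ?lte01//.
move=> lam /= lam0; rewrite /multiplicity; apply/eqP; rewrite eq_le; apply/andP; split.
  apply: ge_ereal_sup => _ [n [psi [ind psiP]] <-]; rewrite lee_fin.
  case: n psi ind psiP => [//|n] psi ind psiP; exfalso; apply: noeig.
  exists lam; split => //; exists (psi ord0) => // psi0.
  have := ind (fun i => (i == ord0)%:R); move=> /(_ _ ord0); rewrite eqxx.
  move=> h; have /eqP : (1 : R[i]) = 0.
    apply: h => x; rewrite (bigD1 ord0)//= psi0 mulr0 add0r big1// => i /negbTE ->.
    by rewrite mul0r.
  by rewrite oner_eq0.
apply: ereal_sup_ubound; exists 0%N => //; exists (fun _ _ => 0).
by split=> [a _ []|[]].
Qed.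

Lemma negative_eigenfunction_real : (1%:E <= kappa_minus b c V)%E ->
  exists lam : R, lam < 0 /\ exists2 w : R -> R, (exists x, w x <> 0) &
    real_graph b c V w (fun x => lam * w x).
Proof.
move=> /kappa_minus_ge1[lam [lam0 [psi psi0 /graphH_real[g1 g2]]]].
exists lam; split => //.
have Rlam : Re \o (fun x => lam%:C * psi x) = fun x => lam * (Re \o psi) x.
  by apply/funext => x /=; case: (psi x) => ? ? /=; ring.
have Ilam : Im \o (fun x => lam%:C * psi x) = fun x => lam * (Im \o psi) x.
  by apply/funext => x /=; case: (psi x) => ? ? /=; ring.
rewrite Rlam in g1; rewrite Ilam in g2.
have [/existsNP[x xP]|/contrapT h1] := pselect (~ (forall x, Re (psi x) = 0)).
  by exists (Re \o psi) => //; exists x.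
have [/existsNP[x xP]|/contrapT h2] := pselect (~ (forall x, Im (psi x) = 0)).
  by exists (Im \o psi) => //; exists x.
exfalso; apply: psi0; apply/funext => x; exact: complex_ext.
Qed.

Lemma imaginary_not_real (t : R) : 0 < t -> (0 +i* t) \isn't Num.real.
Proof.
by move=> t0; rewrite realE !lecE /= negb_or !(gt_eqF t0, lt_eqF t0).
Qed.

Section Main.
Hypotheses (b_gt0 : 0 < b) (c_gt0 : 0 < c) (V_loc : locally_integrable setT V).
Hypothesis V_pinfty : (fun x : R => \int[mu]_(s in `[x, (x + 1)%R]) `|V s|%:E)%E @ +oo --> 0%:E.
Hypothesis V_ninfty : (fun x : R => \int[mu]_(s in `[x, (x + 1)%R]) `|V s|%:E)%E @ -oo --> 0%:E.

(** A negative eigenvalue [- (c m)^2] of the operator gives the eigenvalue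
    [2 i c^2 m] of the pencil. *)
Lemma imaginary_pencil_eigenvalue : (1%:E <= kappa_minus b c V)%E ->
  exists2 t : R, 0 < t & pencil_eigenvalue b c V (0 +i* t).
Proof.
move=> /negative_eigenfunction_real[lam [lam0 [w [x0 wx0] gw]]].
pose m := Num.sqrt (- lam) / c.
have m0 : 0 < m by rewrite divr_gt0// sqrtr_gt0 oppr_gt0.
have lamE : lam = - (c * m) ^+ 2.
  by rewrite /m mulrCA divff ?gt_eqF// mulr1 sqr_sqrtr ?opprK// oppr_ge0 ltW.
rewrite lamE in gw.
pose y x := expR (- m * x) * w x.
have gy : real_graph b c V y (fun x => 2 * c ^+ 2 * m * derive1 y x).
  exact: (real_graph_gauge b_gt0 c_gt0 V_loc V_pinfty V_ninfty m0 gw).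
exists (2 * c ^+ 2 * m); first by rewrite mulr_gt0// mulr_gt0// exprn_gt0.
exists (fun x => (y x)%:C); split.
  move=> /(congr1 (fun f : R -> R[i] => Re (f x0))) /= /eqP.
  by rewrite mulf_eq0 gt_eqF ?expR_gt0//= => /eqP.
have D0 x : derive1 (fun=> 0 : R) x = 0 by apply: derive1_eq; exact: is_derive_cst.
have ImD : Im \o (fun x => (y x)%:C) = fun=> 0 by [].
have dE x : derivC (fun x => (y x)%:C) x = (derive1 y x)%:C.
  by rewrite /Defs.derivC ImD D0.
have -> : (fun x => - 'i%C * (0 +i* (2 * c ^+ 2 * m)) * derivC (fun x => (y x)%:C) x) =
    fun x => (2 * c ^+ 2 * m * derive1 y x)%:C.
  by apply/funext => x; rewrite dE; apply: complex_ext => /=; ring.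
by apply/graphH_real; split; [exact: gy|exact: real_graph0 gy].
Qed.

(** Every solution of [H phi = psi0'] is [a psi0 - x psi0 / (2 c^2)] for some [a]. *)
Lemma D_V_not_negative psi0 : ker_spanned_by b c V psi0 -> ~ (D_V b c V psi0 < 0).
Proof.
move=> [_ kerE]; rewrite ltcE /D_V => /andP[_].
set phi := xget _ _.
have ker0 : kerH b c V psi0.
  by rewrite kerE; exists 1 => //; apply/funext => x; rewrite mul1r.
have [gp gq] := (graphH_real _ _).1 ker0.
set p := Re \o psi0 in gp; set q := Im \o psi0 in gq.
apply/negP; rewrite -leNgt.
(* Without a solution, the default choice is the zero function. *)
have [[phi1 phi1P]|nophi] := pselect
  (exists f : R -> R[i], graphH b c V f (derivC psi0)); last first.
  rewrite /phi xgetPN; last by move=> f fP; apply: nophi; exists f.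
  rewrite /innerL2; have -> : (fun x => 0 * conjc (derivC psi0 x)) = fun=> 0.
    by apply/funext => x; rewrite mul0r.
  by rewrite /integralC /= Rintegral_cst// mul0r.
have /graphH_real[gphi1 gphi2] : graphH b c V phi (derivC psi0).
  have := @xgetPex _ (fun=> 0) [set f | graphH b c V f (derivC psi0)].
  by apply; exists phi1.
pose d := (2 * c ^+ 2)^-1.
(* [phi + x psi0 / (2 c^2)] belongs to the kernel. *)
have hp := real_graph_linear d gphi1
  (real_graph_position b_gt0 c_gt0 V_loc V_pinfty V_ninfty gp).
have hq := real_graph_linear d gphi2
  (real_graph_position b_gt0 c_gt0 V_loc V_pinfty V_ninfty gq).
have c2 : c != 0 by rewrite gt_eqF.
have : kerH b c V (fun x => (Re (phi x) + d * (x * p x)) +i* (Im (phi x) + d * (x * q x))).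
  apply/graphH_real; split.
    rewrite (_ : Re \o (fun=> 0) = fun x => (Re \o derivC psi0) x +
      d * (- (2 * c ^+ 2) * derive1 p x))//.
    apply/funext => x; rewrite -[LHS]/(0 : R).
  by rewrite -[RHS]/(derive1 p x + d * (- (2 * c ^+ 2) * derive1 p x)) /d; field.
  rewrite (_ : Im \o (fun=> 0) = fun x => (Im \o derivC psi0) x +
    d * (- (2 * c ^+ 2) * derive1 q x))//.
  apply/funext => x; rewrite -[LHS]/(0 : R).
  by rewrite -[RHS]/(derive1 q x + d * (- (2 * c ^+ 2) * derive1 q x)) /d; field.
rewrite kerE => -[[al be] _ aE].
have phiE x : Re (phi x) = al * p x - be * q x - d * (x * p x) /\
    Im (phi x) = al * q x + be * p x - d * (x * q x).
  have := congr1 (fun f : R -> R[i] => f x) aE.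
  rewrite /p /q /=; case: (psi0 x) => p0 q0 /= [h1 h2].
  by split; [rewrite h1|rewrite addrC h2]; ring.
have form0 := kernel_form_ge0 b_gt0 c_gt0 V_loc V_pinfty V_ninfty al be gp gq.
apply: (le_trans form0); rewrite le_eqVlt; apply/orP; left; apply/eqP.
rewrite /innerL2 /integralC /=; apply: eq_Rintegral => x _.
have [r1 r2] := phiE x; move: r1 r2; case: (phi x) => f1 f2 /= -> ->.
by rewrite /Defs.derivC /= -!/p -!/q /d; ring.
Qed.
End Main.
End ComplexOperator.

End Pencil.

Local Open Scope complex_scope.

Theorem theorem1p2 (R : realType) (b c : R) (V : R -> R)
  (b_gt0 : 0 < b) (c_gt0 : 0 < c)
  (V_L1loc : locally_integrable setT V)
  (V_pinfty : (fun x : R => \int[lebesgue_measure]_(s in `[x, (x + 1)%R])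
                                 `|V s|%:E)%E @ +oo --> 0%:E)
  (V_ninfty : (fun x : R => \int[lebesgue_measure]_(s in `[x, (x + 1)%R])
                                 `|V s|%:E)%E @ -oo --> 0%:E)
  (kappa_ge1 : (1%:E <= kappa_minus b c V)%E) :
  [/\ ker_trivial b c V -> spectrally_unstable b c V,
      forall psi0 : R -> R[i], ker_spanned_by b c V psi0 ->
        D_V b c V psi0 <> 0 ->
        (spectrally_stable b c V <->
         kappa_minus b c V = 1%:E /\ D_V b c V psi0 < 0) &
      forall psi0 : R -> R[i], ker_spanned_by b c V psi0 ->
        (odd_number (kappa_minus b c V) /\ 0 < D_V b c V psi0) \/
        (even_number (kappa_minus b c V) /\ D_V b c V psi0 < 0) ->
        exists2 t : R, 0 < t & pencil_eigenvalue b c V (0 +i* t)].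
Proof.
have [t t_gt0 eig] :=
  imaginary_pencil_eigenvalue b_gt0 c_gt0 V_L1loc V_pinfty V_ninfty kappa_ge1.
have unstable : spectrally_unstable b c V.
  move=> /(_ (0 +i* t)); apply; split => //; last by left; exact: imaginary_not_real.
  by apply/eqP => -[] /eqP; rewrite gt_eqF.
split => [//|psi0 psi0_ker _|psi0 _ _]; last by exists t.
split => [/unstable//|[_ D_lt0]].
by have := D_V_not_negative b_gt0 c_gt0 V_L1loc V_pinfty V_ninfty psi0_ker D_lt0.
Qed.
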